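(* Let $\lambda>0$ and $\frac12<\alpha\leq1$ be fixed, and let $K\sim\mathcal G(n,\frac{\lambda}{n^\alpha})$ be an Erdős–Rényi graph. Then $$SOV(K)=\frac{1}{2\alpha-1}.$$
   Context: **Graphs.** $V=[n]$ with $n\to+\infty$; $\mathcal S_n$ is the group of permutations of $[n]$. A graph over $V$ is identified with its edge set. For $\sigma\in\mathcal S_n$, $\sigma(\{u,v\})=\{\sigma(u),\sigma(v)\}$, $\sigma(K)=\{\sigma(e):e\in K\}$ and $K\land_\sigma K'=\sigma(K)\cap K'$. $\operatorname{Der}\sigma=\{v\in V:\sigma(v)\neq v\}$. $\mathcal G(n,p)$ is the law of the random graph on $[n]$ in which each edge is present independently with probability $p$. **Balanced load.** Let $\vec E(K)$ be the set of directed edges $(u\to v)$ with $\{u,v\}\in K$. An allocation on $K$ is a map $\theta:\vec E(K)\to[0,1]$ with $\theta(u\to v)+\theta(v\to u)=1$ for all $(u\to v)\in\vec E(K)$; its load is $\partial\theta(v)=\sum_{u:\{u,v\}\in K}\theta(u\to v)$. It is balanced if for every edge $\{u,v\}$, $\partial\theta(u)<\partial\theta(v)$ implies $\theta(u\to v)=0$. Balanced allocations exist and all have the same load function, denoted $w_K:V\to\mathbb R_+$. **Self-overlap.** For real random variables, $\operatorname{plimsup}_{n\to+\infty}X_n=\sup\{x\in\mathbb R:\limsup_n\mathbb P(X_n\geq x)>0\}$. For a sequence of random graphs $K=K_n$ over $[n]$, $$SOV(K)=\lim_{\varepsilon\to0}\operatorname*{plimsup}_{n\to+\infty}\max_{\sigma\in\mathcal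 S_n}\ \max_{\mathcal A\subseteq\operatorname{Der}\sigma,\ |\mathcal A|\geq\varepsilon n}\ \min_{v\in\mathcal A}w_{(K\land_\sigma K)}(v)\in[0,+\infty].$$ *)

(* Defs.v *)
From HB Require Import structures.
From mathcomp Require Import all_boot all_order all_algebra all_fingroup.
From mathcomp Require Import all_classical all_reals all_analysis.

Set Implicit Arguments.
Unset Strict Implicit.
Unset Printing Implicit Defensive.
Import Order.TTheory GRing.Theory Num.Theory.
Import numFieldNormedType.Exports.

Local Open Scope ring_scope.

(* A graph over 'I_n is its edge set, whose elements are two-element sets. *)
Definition pairs (n : nat) : {set {set 'I_n}} := [set e : {set 'I_n} | #|e| == 2%N]%SET.

Definition is_graph (n : nat) (K : {set {set 'I_n}}) : bool := K \subset pairs n.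

Definition perm_edges (n : nat) (s : 'S_n) (K : {set {set 'I_n}}) : {set {set 'I_n}} :=
  [set (s @: e)%SET | e : {set 'I_n} in K]%SET.

Definition overlap (n : nat) (s : 'S_n) (K K' : {set {set 'I_n}}) : {set {set 'I_n}} :=
  (perm_edges s K :&: K')%SET.

Definition Der (n : nat) (s : 'S_n) : {set 'I_n} := [set v | s v != v]%SET.

Section Load.
Context {R : realType} {n : nat}.
Implicit Types (K : {set {set 'I_n}}) (theta : 'I_n -> 'I_n -> R).

(* [theta u v] is the mass on the directed edge u -> v; its value is
   irrelevant when {u, v} is not an edge. *)
Definition allocation K theta : Prop :=
  forall u v, [set u; v]%SET \in K ->
    0 <= theta u v <= 1 /\ theta u v + theta v u = 1.

Definition load K theta (v : 'I_n) : R :=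
  \sum_(u | [set u; v]%SET \in K) theta u v.

Definition balanced K theta : Prop :=
  forall u v, [set u; v]%SET \in K ->
    load K theta u < load K theta v -> theta u v = 0.

(* Every graph has a balanced allocation, and all of them have the same load;
   hence the arbitrary choice made by [xget] is harmless. *)
Definition balanced_load K : 'I_n -> R :=
  load K (xget (fun _ _ => 0)
    [set theta | allocation K theta /\ balanced K theta]%classic).

(* -oo and +oo are the values of an empty max and an empty min. For
   0 < eps <= 1 and n >= 2 the result is a finite nonnegative real: every
   admissible A is nonempty, and an n-cycle s admits A = 'I_n. *)
Definition max_overlap_load (eps : R) K : \bar R :=
  \big[maxe/-oo%E]_(s : 'S_n)
    \big[maxe/-oo%E]_(A : {set 'I_n} |
        (A \subset Der s) && (eps * n%:R <= #|A|%:R))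
      \big[mine/+oo%E]_(v in A) (balanced_load (overlap s K K) v)%:E.

End Load.

Local Open Scope classical_set_scope.

Section Random.
Context {R : realType}.

Definition plimsup (d : nat -> measure_display)
    (T : forall n, measurableType (d n)) (P : forall n, probability (T n) R)
    (X : forall n, T n -> \bar R) : \bar R :=
  ereal_sup [set x%:E | x in
    [set x : R |
      (0 < limn_esup (fun n => P n [set t | x%:E <= X n t]))%E]].

Definition random_graph (d : measure_display) (T : measurableType d) (n : nat)
    (K : T -> {set {set 'I_n}}) : Prop :=
  (forall t, is_graph (K t)) /\ (forall g, measurable [set t | K t = g]).

(* The indicators of the events {e in K} are mutually independent,
   each with success probability p. *)
Definition erdos_renyi (d : measure_display) (T : measurableType d)
    (P : probability T R) (n : nat) (p : R) (K : T -> {set {set 'I_n}}) : Prop :=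
  [/\ random_graph K,
      forall e, e \in pairs n -> P [set t | e \in K t] = p%:E &
      forall (F : {set {set 'I_n}}) (b : {set 'I_n} -> bool),
        F \subset pairs n ->
        P [set t | forall e, e \in F -> (e \in K t) = b e] =
        (\prod_(e in F) P [set t | (e \in K t) = b e])%E].

(* When every K n is a random graph, the function of eps is nonincreasing, so
   that the limit exists. *)
Definition SOV (d : nat -> measure_display)
    (T : forall n, measurableType (d n)) (P : forall n, probability (T n) R)
    (K : forall n, T n -> {set {set 'I_n}}) : \bar R :=
  lim (plimsup P (fun n t => max_overlap_load eps (K n t)) @[eps --> (0:R)^'+]).

End Random.

(* Main.v *)
Require Import Defs.
From HB Require Import structures.
From mathcomp Require Import all_boot all_order all_algebra all_fingroup.
From mathcomp Require Import all_classical all_reals all_analysis.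
From mathcomp Require Import zify ring lra.
Import Order.TTheory GRing.Theory Num.Theory.
Import numFieldNormedType.Exports.

(** Write p = lambda / n^alpha and c = 1 / (2 alpha - 1).

    Upper bound. If the loads of the overlap are at least x on A, let B be the set
    of all vertices of load at least x. Only the values of sigma^-1 on B matter, so
    sigma^-1 may be replaced by the permutation tau with the same values on B and as
    many cycles as possible. Give a vertex of a tau-cycle of length l inside B the
    weight 1 - 1/l, and a vertex of B on a broken cycle the weight 1. The weights add
    up to k(tau) = n - #cycles(tau), and since mass flows to the less loaded endpoint,
    x k(tau) is at most the sum over the edges e inside B with e, tau(e) in K of the
    maximal weight of the endpoints of e. With s of order n^(2 alpha - 1), the
    exponential moment of this sum with base 1 + s is at most exp(O(n)): by Jensen's
    inequality one may remove a uniform edge from every cycle of edges, and along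
    paths of edges the expectation is computed by successive integration. Since
    n s^-x is a negative power of n for x > c, and the sum over tau of n^-k(tau) is
    prod_(i < n) (1 + i/n) <= 2^n, the union bound over B and tau tends to 0.

    Lower bound. Fix a small set of seeds, and look for pairs of disjoint paths of
    length r with about r (c - 1) seed edges, spread evenly and attached to the same
    seeds on both paths. Every subgraph of this gadget is sparse enough for the
    second moment method to produce, with probability bounded below, linearly many
    gadgets with disjoint paths. The involution exchanging the two paths of each
    gadget and fixing all other vertices has an overlap with about c edges per path
    vertex, hence loads close to c on linearly many vertices moved by it. *)

Set Implicit Arguments.
Unset Strict Implicit.
Unset Printing Implicit Defensive.
Local Open Scope classical_set_scope.
Local Open Scope ring_scope.

(** * Independent edges on a finite index set *)

Section ProductMeasure.
Context {R : realFieldType} {I : finType}.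
Implicit Types (p t : I -> R) (g S : {set I}) (f : {set I} -> R).

Definition prodmu p g : R := \prod_i (if i \in g then p i else 1 - p i).

Definition Ex p f : R := \sum_g prodmu p g * f g.

(** Independence: distributing the product over [i] expands it into a sum over the subsets of
    [I]. *)
Lemma ExM p (a b : I -> R) :
  Ex p (fun g => \prod_i (if i \in g then a i else b i)) =
  \prod_i (p i * a i + (1 - p i) * b i).
Proof.
rewrite bigA_distr; apply: eq_bigr => g _.
by rewrite -big_split; apply: eq_bigr => i _; case: ifP.
Qed.

Lemma eq_Ex p f1 f2 : f1 =1 f2 -> Ex p f1 = Ex p f2.
Proof. by move=> e; apply: eq_bigr => g _; rewrite e. Qed.

Lemma ExD p f1 f2 : Ex p (fun g => f1 g + f2 g) = Ex p f1 + Ex p f2.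
Proof. by rewrite -big_split; apply: eq_bigr => g _; rewrite mulrDr. Qed.

Lemma ExZ p (a : R) f : Ex p (fun g => a * f g) = a * Ex p f.
Proof. by rewrite mulr_sumr; apply: eq_bigr => g _; rewrite mulrCA. Qed.

Lemma Ex_sum p (J : finType) (P : pred J) (F : J -> {set I} -> R) :
  Ex p (fun g => \sum_(j | P j) F j g) = \sum_(j | P j) Ex p (F j).
Proof. by rewrite exchange_big; apply: eq_bigr => g _; rewrite mulr_sumr. Qed.

Lemma Ex1 p : Ex p (fun=> 1) = 1.
Proof.
transitivity (Ex p (fun g => \prod_i (if i \in g then 1 else 1 : R))).
  by apply: eq_Ex => g; rewrite big1 // => i _; rewrite if_same.
by rewrite ExM big1 // => i _; ring.
Qed.

Lemma Ex_set p S :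
  Ex p (fun g => if S \subset g then 1 else 0) = \prod_(i in S) p i.
Proof.
transitivity (Ex p (fun g => \prod_i (if i \in g then 1 else (i \notin S)%:R : R))).
  apply: eq_Ex => g; case: ifP => [/fintype.subsetP sSg|/negP/negP/subsetPn[i iS ig]].
    rewrite big1 // => i _; case: ifP => // /negP ig.
    by case: (boolP (i \in S)) => // /sSg.
  by rewrite (bigD1 i) //= (negPf ig) iS mul0r.
rewrite ExM [RHS]big_mkcond; apply: eq_bigr => i _.
by case: (i \in S) => /=; ring.
Qed.


Section Prob.
Variable p : I -> R.
Hypothesis p01 : forall i, 0 <= p i <= 1.

Lemma prodmu_ge0 g : 0 <= prodmu p g.
Proof.
apply: prodr_ge0 => i _; have /andP[h1 h2] := p01 i.
by case: ifP; rewrite ?subr_ge0.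
Qed.

Lemma ler_Ex f1 f2 : (forall g, f1 g <= f2 g) -> Ex p f1 <= Ex p f2.
Proof. by move=> h; apply: ler_sum => g _; rewrite ler_wpM2l ?prodmu_ge0. Qed.

(** Conditioning on the state of [e]: the subsets pair up as [g] and [e |: g] with [e \notin g], and
    both weights share the factor [m] of the other elements. *)
Lemma Ex_cond f e :
  Ex p f = Ex p (fun g => (1 - p e) * f (g :\ e)%SET + p e * f (e |: g)%SET).
Proof.
pose m g := \prod_(i | i != e) (if i \in g then p i else 1 - p i).
have mE g : prodmu p g = (if e \in g then p e else 1 - p e) * m g.
  by rewrite /prodmu (bigD1 e).
have mU g : m (e |: g)%SET = m g.
  by apply: eq_bigr => i /negPf ie; rewrite !inE ie.
have mD g : m (g :\ e)%SET = m g.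
  by apply: eq_bigr => i ie; rewrite !inE ie.
have split (F : {set I} -> R) : \sum_g F g = \sum_(g : {set I} | e \notin g) (F g + F (e |: g)%SET).
  rewrite big_split /= (bigID (fun g : {set I} => e \notin g)) /=; congr (_ + _).
  rewrite (reindex_onto (fun g : {set I} => e |: g)%SET (fun g => g :\ e)%SET) /=.
    apply: eq_bigl => g; rewrite negbK !inE eqxx /=.
    apply/eqP/idP => [<-|h]; first by rewrite !inE eqxx.
    by rewrite finset.setU1K.
  by move=> g; rewrite negbK => h; rewrite finset.setD1K.
rewrite /Ex (split (fun g => _ * f g)) [RHS]split; apply: eq_bigr => g eg.
rewrite !mE mU !inE eqxx (negPf eg) /= finset.setU1K //.
have -> : (g :\ e)%SET = g.
  by apply/setP => i; rewrite !inE; case: eqP => // ->; rewrite (negPf eg).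
by rewrite finset.setUA finset.setUid; ring.
Qed.

End Prob.
End ProductMeasure.

(** * Successive integration along paths *)

Section AcyclicBound.
Context {R : realFieldType} {I : finType}.
Variables (te : I -> I) (p : I -> R) (P s : R).
Hypotheses (te_inj : injective te) (p0P : forall i, 0 <= p i <= P).
Hypotheses (P1 : P <= 1) (s_ge0 : 0 <= s) (Ps : P * s <= 1 / 2).

(** For an injective [te] this means that [S] contains no cycle of [te]; the element [e] starts a
    path of [S1]. *)
Definition acyclic (S : {set I}) :=
  forall S1 : {set I}, S1 \subset S -> S1 != finset.set0 ->
    exists2 e, e \in S1 & e \notin (te @: S1)%SET.

(* Integrating out an element of [S] without predecessor turns the factor
   [1 + s K_e K_(te e)] into a weight of order [P s] on [te e]. *)
Lemma acyclic_bound (S : {set I}) (t : I -> R) : acyclic S ->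
  (forall i, 0 <= t i) -> {in S, forall i, t i <= 1} ->
  {in (te @: S)%SET, forall i, t i = 0} ->
  Ex p (fun g => \prod_(e in S) (1 + s * ((e \in g) && (te e \in g))%:R) *
                 \prod_e (1 + t e * (e \in g)%:R)) <=
  (1 + 2 * P ^+ 2 * s) ^+ #|S| * \prod_e (1 + P * t e).
Proof.
have p01 i : 0 <= p i <= 1.
  by have /andP[-> h] := p0P i; rewrite (le_trans h).
elim: {S}_.+1 {-2}S (ltnSn #|S|) t => // k IH S Sk t acS t0 t1 teS.
have [->|SN0] := eqVneq S finset.set0.
  rewrite cards0 expr0 mul1r.
  have -> : Ex p (fun g => \prod_(e in finset.set0)
      (1 + s * ((e \in g) && (te e \in g))%:R) *
      \prod_e (1 + t e * (e \in g)%:R)) = \prod_e (1 + p e * t e).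
    transitivity (Ex p (fun g => \prod_e (if e \in g then 1 + t e else 1))).
      apply: eq_Ex => g; rewrite big1 ?mul1r => [|i]; last by rewrite finset.in_set0.
      by apply: eq_bigr => e _; case: ifP => _; rewrite ?mulr1 ?mulr0 ?addr0.
    by rewrite ExM; apply: eq_bigr => e _; ring.
  apply: ler_prod => e _; have /andP[p0 pP] := p0P e.
  by rewrite addr_ge0 ?mulr_ge0 //= lerD2l ler_wpM2r.
have [e0 e0S e0te] := acS S (fintype.subxx _) SN0.
have te0 : te e0 != e0 by apply: contra e0te => /eqP {1}<-; apply: imset_f.
have tte0 : t (te e0) = 0 by apply: teS; apply: imset_f.
have P0 : 0 <= P by have /andP[h /(le_trans h)] := p0P e0.
(* When [te e0] is present, the average over [e0] is at most [1 + P * t e0 + P * s * (1 + t e0)],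
   which is at most [(1 + P * t e0) * (1 + 2 * P * s)] because [t e0 <= 1]. The bound
   [P * s <= 1 / 2] keeps the new weight at most 1. *)
pose t' e := if e == e0 then 0 else if e == te e0 then 2 * P * s else t e.
pose rest (g : {set I}) := \prod_(e in S | e != e0) (1 + s * ((e \in g) && (te e \in g))%:R) *
               \prod_(e | (e != e0) && (e != te e0)) (1 + t e * (e \in g)%:R).
have restE (g1 g2 : {set I}) : (forall e, e != e0 -> (e \in g1) = (e \in g2)) ->
    rest g1 = rest g2.
  move=> h; congr (_ * _); apply: eq_bigr => e.
    move=> /andP[eS ee0]; rewrite !h //.
    by apply: contraNneq e0te => <-; apply: imset_f.
  by move=> /andP[ee0 _]; rewrite h.
have rest0 g : 0 <= rest g.
  by rewrite mulr_ge0 // prodr_ge0 // => e _; rewrite addr_ge0 // mulr_ge0.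
have fE (g : {set I}) : \prod_(e in S) (1 + s * ((e \in g) && (te e \in g))%:R) *
    \prod_e (1 + t e * (e \in g)%:R) =
    (1 + s * ((e0 \in g) && (te e0 \in g))%:R) * (1 + t e0 * (e0 \in g)%:R) * rest g.
  rewrite (bigD1 e0) //= [X in _ * X = _](bigD1 e0) //=.
  rewrite [X in _ * (_ * X) = _](bigD1 (te e0)) //= tte0 mul0r addr0 mul1r /rest; ring.
have [p0 pP] := andP (p0P e0).
have t00 := t0 e0; have t10 := t1 _ e0S.
rewrite (eq_Ex _ fE) (Ex_cond p _ e0).
pose S' := (S :\ e0)%SET.
have S'S : S' \subset S by rewrite subsetDl.
have IH' : Ex p (fun g => \prod_(e in S') (1 + s * ((e \in g) && (te e \in g))%:R) *
                 \prod_e (1 + t' e * (e \in g)%:R)) <=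
  (1 + 2 * P ^+ 2 * s) ^+ #|S'| * \prod_e (1 + P * t' e).
  apply: IH.
  - by move: Sk; rewrite (cardsD1 e0) e0S.
  - by move=> S1 S1S; apply: acS; apply: fintype.subset_trans S'S.
  - move=> i; rewrite /t'; case: eqP => // _; case: eqP => // _.
    by rewrite !mulr_ge0.
  - move=> i; rewrite !inE /t' => /andP[/negPf -> iS]; case: eqP => _; last exact: t1.
    by move: Ps; rewrite -mulrA; set z := P * s => h; lra.
  - move=> i /imsetP[j]; rewrite !inE => /andP[je0 jS] ->; rewrite /t'.
    case: eqP => // _; case: eqP => [/te_inj je|_]; first by rewrite je eqxx in je0.
    by apply: teS; apply: imset_f.
have -> : (1 + 2 * P ^+ 2 * s) ^+ #|S| * \prod_e (1 + P * t e) =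
   (1 + P * t e0) * ((1 + 2 * P ^+ 2 * s) ^+ #|S'| * \prod_e (1 + P * t' e)).
  have -> : \prod_e (1 + P * t' e) = (1 + P * (2 * P * s)) *
      \prod_(e | (e != e0) && (e != te e0)) (1 + P * t e).
    rewrite (bigD1 e0) // (bigD1 (te e0)) //= /t' !eqxx (negPf te0) mulr0 addr0 mul1r.
    congr (_ * _); apply: eq_bigr => e.
    by move=> /andP[/negPf -> /negPf ->].
  rewrite (cardsD1 e0) e0S (exprS (1 + _)) (bigD1 e0) // (bigD1 (te e0)) //= tte0.
  by rewrite /S' mulr0 addr0; ring.
apply: le_trans (ler_wpM2l _ IH'); last by rewrite addr_ge0 ?mulr_ge0.
rewrite -ExZ; apply: ler_Ex => // g.
have -> : \prod_(e in S') (1 + s * ((e \in g) && (te e \in g))%:R) *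
   \prod_e (1 + t' e * (e \in g)%:R) = (1 + 2 * P * s * (te e0 \in g)%:R) * rest g.
  rewrite [X in _ * X = _](bigD1 e0) // (bigD1 (te e0)) //= {1 2}/t' !eqxx (negPf te0) mul0r addr0 mul1r.
  rewrite mulrCA /rest; congr (_ * (_ * _)).
    by apply: eq_bigl => e; rewrite !inE andbC.
  by apply: eq_bigr => e /andP[/negPf a /negPf b]; rewrite /t' a b.
rewrite (restE (g :\ e0)%SET g) 1?(restE (e0 |: g)%SET g); try by move=> e /negPf ee0; rewrite !inE ee0.
rewrite !inE eqxx (negPf te0) /= !mulr0 !addr0 !mul1r.
move: (rest g) (rest0 g) => r r0; rewrite !mulrA -mulrDl ler_wpM2r //.
case: (te e0 \in g); rewrite ?mulr1 ?mulr0 ?addr0.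
  have h1 : p e0 * s <= P * s by rewrite ler_wpM2r.
  have h2 : p e0 * t e0 <= P * t e0 by rewrite ler_wpM2r.
  have h3 : p e0 * s * t e0 <= P * s * t e0 by rewrite ler_wpM2r.
  have h4 : P * s * t e0 <= P * s by rewrite ler_piMr // mulr_ge0.
  have h5 : 0 <= P * t e0 * (2 * P * s) by rewrite !mulr_ge0.
  nra.
have h2 : p e0 * t e0 <= P * t e0 by rewrite ler_wpM2r.
nra.
Qed.
End AcyclicBound.

(** * Permutations counted by their number of cycles *)

Section PermRank.
Context {T : finType}.
Implicit Types (s t : {perm T}) (A B : {set T}).
Local Open Scope group_scope.

(** The least number of transpositions whose product is [s]. *)
Definition prank s : nat := (#|T| - #|porbits s|)%N.

Lemma card_porbits_le s : (#|porbits s| <= #|T|)%N.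
Proof. exact: leq_imset_card. Qed.

Lemma prank_card s : (prank s + #|porbits s| = #|T|)%N.
Proof. by rewrite subnK ?card_porbits_le. Qed.

Lemma porbit_fixed s x : s x = x -> porbit s x = [set x]%SET.
Proof.
move=> sx; apply/setP => y; rewrite inE; apply/idP/eqP => [|->]; last exact: porbit_id.
move=> /porbitP[i ->]; rewrite permX.
by elim: i => //= i ->.
Qed.

(** The transposition joins the fixed point [x] to the cycle of [y], so one cycle is lost. *)
Lemma prank_tperm s x y : s x = x -> x != y ->
  prank (tperm x y * s) = (prank s).+1.
Proof.
move=> sx xy; have /= := porbits_mul_tperm s x y; rewrite xy porbit_sym porbit_fixed //.
rewrite inE eq_sym xy /= => e.
have := prank_card (tperm x y * s); have := prank_card s; move: e.
by move: #|porbits s| #|porbits (tperm x y * s)| => a b; lia.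
Qed.

Lemma prank1 : prank (1 : {perm T}) = 0%N.
Proof.
rewrite /prank /porbits card_in_imset ?subnn // => x y _ _.
by rewrite !porbit_fixed ?perm1 // => /finset.set1_inj.
Qed.

(** Generating function of the Stirling numbers of the first kind. Induction on [A], according to
    [y = s^-1 a]: either [a] is fixed, or [s] is [tperm a y] times a permutation of [A :\ a], whose
    rank is smaller by one. *)
Lemma sum_prank_on (R : comNzRingType) (z : R) A :
  (\sum_(s : {perm T} | perm_on A s) z ^+ prank s = \prod_(i < #|A|) (1 + i%:R * z))%R.
Proof.
elim: {A}_.+1 {-2}A (ltnSn #|A|) => // k IH A Ak.
have [->|[a aA]] := set_0Vmem A.
  rewrite cards0 big_ord0 (big_pred1 1) ?prank1 ?expr0 // => s.
  apply/idP/eqP => [h|->]; last exact: perm_on1.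
  by apply/permP => x; rewrite perm1 (out_perm h) ?inE.
pose A' := (A :\ a)%SET.
have cA : #|A| = #|A'|.+1 by rewrite (cardsD1 a) aA.
rewrite cA big_ord_recr /= -IH; last by rewrite -ltnS -cA.
rewrite (partition_big (fun s => s^-1 a) (mem A)) /=; last first.
  by move=> s sA; rewrite -(perm_closed _ sA) permKV.
rewrite (bigD1 a) //= mulrDr mulr1; congr (_ + _)%R.
  apply: eq_bigl => s; apply/andP/idP => [[sA /eqP sa]|sA].
    apply/fintype.subsetP => x xs; rewrite !inE.
    rewrite (fintype.subsetP sA _ xs) andbT.
    by apply: contraNneq xs => ->; rewrite -{1}sa permKV.
  split; first by apply: fintype.subset_trans sA _; apply: subsetDl.
  by rewrite -{1}(out_perm sA (x := a)) ?permK // !inE eqxx.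
transitivity (\sum_(y in A') \sum_(s | perm_on A' s) z ^+ prank s * z)%R; last first.
  by rewrite sumr_const -mulr_suml mulr_natl mulrnAr.
apply: eq_big => [y|y]; first by rewrite !inE andbC.
case/andP=> yA ya.
rewrite (reindex_inj (mulgI (tperm a y))) /=; apply: eq_big => [s|s].
  apply/andP/idP => [[sA /eqP sa]|sA].
    have sa' : s a = a.
      by rewrite -{2}(permKV (tperm a y * s) a) sa permM tpermR.
    apply/fintype.subsetP => x xs; rewrite !inE.
    have xa : x != a by apply: contraNneq xs => ->; rewrite sa'.
    rewrite xa /=; have [->//|xy] := eqVneq x y.
    by apply: (fintype.subsetP sA); rewrite inE permM tpermD // eq_sym.
  have sa : s a = a by apply: (out_perm sA); rewrite !inE eqxx.
  have sai : s^-1 a = a by rewrite -{1}sa permK.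
  split; last by rewrite invMg permM tpermV sai tpermL.
  apply: perm_onM; last by apply: fintype.subset_trans sA _; apply: subsetDl.
  by apply/fintype.subsetP => x; rewrite inE; case: tpermP => [->|->|]; rewrite ?eqxx.
case/andP=> sA /eqP sa; rewrite prank_tperm ?exprSr //; last by rewrite eq_sym.
by rewrite -{2}(permKV (tperm a y * s) a) sa permM tpermR.
Qed.

Lemma sum_prank (R : realFieldType) :
  (\sum_(s : {perm T}) (#|T|%:R^-1 : R) ^+ prank s <= 2 ^+ #|T|)%R.
Proof.
rewrite (eq_bigl (perm_on [set: T]%SET)); last first.
  by move=> s; apply/esym/fintype.subsetP => x _; rewrite inE.
rewrite sum_prank_on cardsT -[X in (_ <= 2 ^+ X)%R]card_ord -prodr_const.
apply: ler_prod => i _; rewrite addr_ge0 ?mulr_ge0 ?invr_ge0 ?ler0n //=.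
have T0 : (0 < #|T|)%N by apply: leq_ltn_trans (ltn_ord i).
suff : (i%:R / #|T|%:R <= 1 :> R)%R by lra.
by rewrite ler_pdivrMr ?ltr0n // mul1r ler_nat ltnW.
Qed.

(* Composing with the transposition of two points of the same cycle outside [B]
   splits this cycle and does not change the values on [B]. *)
Lemma exists_prank_min s B : exists t,
  {in B, t =1 s} /\ (forall a b, a \notin B -> b \notin B -> b \in porbit t a -> a = b).
Proof.
have h0 : [forall x in B, s x == s x] by apply/forall_inP.
case: (@arg_maxnP _ s (fun t => [forall x in B, t x == s x]) (fun t => #|porbits t|) h0).
move=> t /forall_inP tB tmax; exists t; split; first by move=> x xB; apply/eqP/tB.
move=> a b aB bB ba; apply/eqP; apply: contraT => ab.
have /= := porbits_mul_tperm t a b; rewrite ab porbit_sym ba addn0 => e.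
have : (#|porbits (tperm a b * t)| <= #|porbits t|)%N.
  apply: tmax; apply/forall_inP => x xB; rewrite permM tpermD; first exact: tB.
    by apply: contraNneq aB => ->.
  by apply: contraNneq bB => ->.
by rewrite e addn1 ltnn.
Qed.

Lemma expg_fix_dvd s r x : (s ^+ r) x = x -> (#|porbit s x| %| r)%N.
Proof.
set l := #|porbit s x| => e.
have l0 : (0 < l)%N by apply/card_gt0P; exists x; apply: porbit_id.
have it q : iter (q * l) s x = x.
  elim: q => // q IHq; rewrite mulSn iterD IHq; exact: iter_porbit.
have : iter (r %% l) s x = x.
  by move: e; rewrite permX {1}(divn_eq r l) addnC iterD it.
have rl := ltn_pmod r l0.
rewrite /dvdn; have := uniq_traject_porbit s x; rewrite -/l => u.
rewrite -(nth_traject s rl) => e2.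
have := nth_uniq x _ _ u; rewrite size_traject => /(_ _ 0%N rl l0).
by rewrite e2 (nth_traject s l0) /= eqxx => <-.
Qed.

End PermRank.

(** * Vertex weights of a permutation *)

Section PermWeight.
Context {R : realFieldType} {T : finType}.
Variables (s : {perm T}) (B : {set T}).

(* A cycle of length [l] has at most one point outside [B] in the situation of
   [exists_prank_min], so that its weights add up to at least [l - 1]. *)
Definition pweight (v : T) : R :=
  if v \in B then (if porbit s v \subset B then 1 - #|porbit s v|%:R^-1 else 1) else 0.

Lemma card_porbit_gt0 v : (0 < #|porbit s v|)%N.
Proof. by apply/card_gt0P; exists v; apply: porbit_id. Qed.

Lemma pweight_itv v : 0 <= pweight v <= 1.
Proof.
rewrite /pweight; have h : (1 : R) <= #|porbit s v|%:R by rewrite ler1n card_porbit_gt0.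
have h2 : #|porbit s v|%:R^-1 <= (1 : R) by rewrite invf_le1 // (lt_le_trans _ h).
have h3 : (0 : R) <= #|porbit s v|%:R^-1 by rewrite invr_ge0 ler0n.
by case: ifP => _; [case: ifP => _|]; lra.
Qed.

Lemma sum_porbit (F : T -> R) :
  \sum_v F v = \sum_(O in porbits s) \sum_(v in O) F v.
Proof.
rewrite (partition_big (porbit s) (mem (porbits s))) /=; last first.
  by move=> v _; apply: imset_f.
apply: eq_bigr => O /imsetP[w _ ->]; apply: eq_bigl => v.
by rewrite eq_porbit_mem.
Qed.

(** On a cycle of length [l] the terms [1 / l] add up to 1, so that their total counts the
    cycles. *)
Lemma prankE : \sum_v (1 - #|porbit s v|%:R^-1 : R) = (prank s)%:R.
Proof.
rewrite /prank natrB ?card_porbits_le // -[in RHS]cardsT.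
rewrite -sum1_card natr_sum (eq_bigl predT) => [|v]; last by rewrite inE.
rewrite sumrB; congr (_ - _).
rewrite sum_porbit -sum1_card natr_sum; apply: eq_bigr => O /imsetP[w _ ->].
rewrite (eq_bigr (fun=> #|porbit s w|%:R^-1)) => [|v]; last first.
  by rewrite -eq_porbit_mem => /eqP ->.
by rewrite sumr_const -[_ *+ _]mulr_natr mulVf // pnatr_eq0 -lt0n card_porbit_gt0.
Qed.

(** The cycle of a moved point has length at least 2, so this point contributes at least [1 / 2] to
    [prankE]. *)
Lemma prank_support (D : {set T}) : {in D, forall v, s v != v} ->
  (#|D|%:R : R) / 2 <= (prank s)%:R.
Proof.
move=> hD; rewrite -prankE -sum1_card natr_sum mulr_suml big_mkcond /=.
apply: ler_sum => v _; case: ifP => [vD|_]; last first.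
  rewrite subr_ge0 invf_le1 ?ltr0n ?card_porbit_gt0 //.
  by rewrite ler1n card_porbit_gt0.
have h2 : (2 <= #|porbit s v|)%N.
  have <- : #|[set v; s v]%SET| = 2%N by rewrite cards2 eq_sym hD.
  apply: subset_leq_card; apply/fintype.subsetP => u.
  by rewrite !inE => /orP[] /eqP->; rewrite ?porbit_id // (mem_porbit s 1).
have : #|porbit s v|%:R^-1 <= (2^-1 : R) by rewrite lef_pV2 ?posrE ?ltr0n ?card_porbit_gt0 ?ler_nat.
lra.
Qed.

Lemma prank_pweight :
  (forall a b, a \notin B -> b \notin B -> b \in porbit s a -> a = b) ->
  (prank s)%:R <= \sum_v pweight v.
Proof.
move=> h; rewrite -prankE !sum_porbit; apply: ler_sum => O /imsetP[w _ ->].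
have wE v : v \in porbit s w -> porbit s v = porbit s w.
  by rewrite -eq_porbit_mem => /eqP.
rewrite (eq_bigr (fun=> 1 - #|porbit s w|%:R^-1)) => [|v /wE ->//].
have [sB|nsB] := boolP (porbit s w \subset B).
  apply: ler_sum => v vw; rewrite /pweight (fintype.subsetP sB _ vw) wE //.
  by rewrite sB.
(* [a] is the only point of this cycle outside [B]; the others have weight 1 and add up to the
   length minus 1. *)
have [a aw aB] := subsetPn nsB.
rewrite sumr_const -[_ *+ _]mulr_natr mulrBl mul1r mulVf ?pnatr_eq0 -?lt0n ?card_porbit_gt0 //.
rewrite (big_setD1 a) //= (eq_bigr (fun=> 1 : R)) => [|v].
  rewrite /pweight (negPf aB) add0r sumr_const (cardsD1 a (porbit s w)) aw.
  by rewrite natrD addrC addKr.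
rewrite !inE => /andP[va vw]; rewrite /pweight wE // (negPf nsB).
case: (boolP (v \in B)) => // vB.
case/eqP: va; apply: h => //.
by rewrite (wE v vw).
Qed.
End PermWeight.

(** * Exponential moment of the weighted overlap *)

(** Jensen's inequality, by averaging the tangent line bound at the mean [a]. *)
Lemma expR_avg (R : realType) (N : nat) (z : 'I_N -> R) : (0 < N)%N ->
  expR (N%:R^-1 * \sum_r z r) <= N%:R^-1 * \sum_r expR (z r).
Proof.
move=> N0; have NR : N%:R != 0 :> R by rewrite pnatr_eq0 -lt0n.
set a := _ * _.
have h r : expR a * (1 + (z r - a)) <= expR (z r).
  have -> : expR (z r) = expR a * expR (z r - a) by rewrite -expRD addrC subrK.
  by rewrite ler_wpM2l ?expR_ge0 ?expR_ge1Dx.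
have : N%:R^-1 * \sum_r expR a * (1 + (z r - a)) <= N%:R^-1 * \sum_r expR (z r).
  by rewrite ler_wpM2l ?invr_ge0 ?ler0n // ler_sum.
suff -> : N%:R^-1 * \sum_r expR a * (1 + (z r - a)) = expR a by [].
rewrite -mulr_sumr big_split sumrB /= !sumr_const card_ord.
have -> : \sum_i z i = N%:R * a by rewrite /a mulrA mulfV ?mul1r.
by rewrite -[_ *+ N]mulr_natl; field.
Qed.

Section OverlapMoment.
Context {R : realType} {T : finType}.
Variables (tau : {perm T}) (B : {set T}) (p : {set T} -> R) (P s : R).
Hypotheses (p0P : forall e, 0 <= p e <= P).
Hypotheses (P1 : P <= 1) (s_ge0 : 0 <= s) (Ps : P * s <= 1 / 2).

Let te (e : {set T}) : {set T} := (tau @: e)%SET.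

Definition pairs_in : {set {set T}} := [set e : {set T} | (#|e| == 2%N) && (e \subset B)]%SET.

Definition edge_weight (e : {set T}) : R := \big[Num.max/0]_(v in e) pweight tau B v.

Definition weighted_overlap (g : {set {set T}}) : R :=
  \sum_(e in pairs_in) edge_weight e * ((e \in g) && (te e \in g))%:R.

Let N := #[tau]%g.

Lemma iter_im r e : iter r te e = [set (tau ^+ r)%g x | x in e]%SET.
Proof.
elim: r e => [|r IH] e.
  by rewrite /= (eq_imset (g := id)) ?imset_id // => x; rewrite expg0 perm1.
rewrite iterS IH /te -imset_comp; apply: eq_imset => x /=.
by rewrite expgSr permM.
Qed.

Lemma te_inj : injective te.
Proof. exact/imset_inj/perm_inj. Qed.

(* These orbits of edges can be twice shorter than the orbits of their vertices,
   which spoils the averaging argument; there are at most [#|T|] such edges, and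
   [K_e K_(te e) <= K_e] is enough for them. *)
Definition antipodal : {set {set T}} :=
  [set e : {set T} | (#|e| == 2%N) &&
    [exists r : 'I_N, (iter r te e == e) && [exists v in e, (tau ^+ r)%g v != v]]]%SET.

Lemma antipodalP (r : nat) (e : {set T}) v : #|e| = 2%N -> e \notin antipodal ->
  iter r te e = e -> v \in e -> (tau ^+ r)%g v = v.
Proof.
move=> e2; rewrite inE e2 eqxx /= negb_exists => /forallP h it ve.
have rN : (r %% N < N)%N by rewrite ltn_pmod ?order_gt0.
have := h (Ordinal rN); rewrite /= negb_and.
have -> : iter (r %% N) te e = e.
  by rewrite -[RHS]it !iter_im; apply: eq_imset => x; rewrite expg_mod_order.
rewrite eqxx /= => /existsPn /(_ v); rewrite ve /= negbK => /eqP.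
by rewrite expg_mod_order.
Qed.

Lemma antipodal_te e : e \notin antipodal -> te e \notin antipodal.
Proof.
apply: contra; rewrite !inE card_imset; last exact: perm_inj.
case/andP=> -> /existsP[r /andP[/eqP it /existsP[v /andP[vte vr]]]] /=.
apply/existsP; exists r; apply/andP; split.
  by apply/eqP/te_inj; rewrite -[RHS]it -iterS iterSr.
move: vte vr => /imsetP[u ue ->] vr; apply/existsP; exists u; rewrite ue /=.
apply: contraNneq vr => ur; apply/eqP.
by rewrite -permM -expgS expgSr permM ur.
Qed.

(** If [tau ^+ r] exchanges the endpoints of an edge, the length [l] of their common cycle divides
    [2 r] but not [r]. The endpoints are then opposite points of the cycle, and either one
    determines the edge. *)
Lemma card_antipodal : (#|antipodal| <= #|T|)%N.
Proof.
apply: leq_trans (leq_imset_card (fun u => [set u; (tau ^+ (#|porbit tau u|)./2)%g u]%SET) T).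
apply: subset_leq_card; apply/fintype.subsetP => e; rewrite inE.
case/andP=> e2 /existsP[r /andP[/eqP it /existsP[v /andP[ve vr]]]].
set w := (tau ^+ r)%g v in vr.
have rE x : x \in e -> (tau ^+ r)%g x \in e.
  by move=> xe; rewrite -it iter_im; apply: imset_f.
have we : w \in e by apply: rE.
have eE : e = [set v; w]%SET.
  apply/esym/eqP; rewrite eqEcard cards2 (eqP e2) eq_sym vr andbT.
  by apply/fintype.subsetP => x; rewrite !inE => /orP[] /eqP->.
have wv : (tau ^+ r)%g w = v.
  have := rE w we; rewrite {1}eE !inE => /orP[/eqP//|/eqP h].
  by case/eqP: vr; apply: (@perm_inj _ (tau ^+ r)%g).
apply/imsetP; exists v => //; rewrite eE; congr (_ |: [set _])%SET.
set l := #|porbit tau v|.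
have l0 : (0 < l)%N by apply: card_porbit_gt0.
have d2 : (l %| r + r)%N by apply: expg_fix_dvd; rewrite expgD permM.
have nd : ~~ (l %| r)%N.
  apply: contra vr => /dvdnP[q qr]; rewrite /w qr permX.
  by elim: q {qr} => //= q /eqP IHq; rewrite mulSn iterD IHq; apply/eqP/iter_porbit.
have m0 : (0 < r %% l)%N by rewrite lt0n.
have ml := ltn_pmod r l0.
have d3 : (l %| r %% l + r %% l)%N by rewrite /dvdn modnDm; apply: d2.
have /eqP h : (r %% l + r %% l == l)%N.
  case/dvdnP: d3 => [[|[|q]]] e3; lia.
have -> : (l./2 = r %% l)%N by lia.
have itl q : iter (q * l) tau v = v.
  by elim: q => // q IHq; rewrite mulSn iterD IHq; apply: iter_porbit.
by rewrite /w !permX {1}(divn_eq r l) addnC iterD itl.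
Qed.

Let full e := [forall r : 'I_N, iter r te e \in pairs_in].

Lemma fullP e r : full e -> iter r te e \in pairs_in.
Proof.
move=> /forallP h; have rN : (r %% N < N)%N by rewrite ltn_pmod ?order_gt0.
have := h (Ordinal rN); rewrite /= !iter_im.
by under eq_imset do rewrite expg_mod_order.
Qed.

(* [removed r] meets every orbit of [te] contained in [pairs_in] exactly once, at
   a point which is uniform on the orbit when [r] is uniform; hence [kept r] is
   acyclic, and it contains an edge with probability at least its weight. *)
Let removed (r : nat) := [set e | full e & iter r te (froot te e) == e]%SET.

Let kept (r : nat) := (pairs_in :\: antipodal :\: removed r)%SET.

Lemma edge_weight_ge v (e : {set T}) : v \in e -> pweight tau B v <= edge_weight e.
Proof. by move=> ve; apply: (le_bigmax_cond _ (fun v => pweight tau B v)). Qed.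

Lemma edge_weight_le (e : {set T}) (c : R) : 0 <= c ->
  (forall v, v \in e -> pweight tau B v <= c) -> edge_weight e <= c.
Proof. by move=> c0 h; apply/bigmax_leP. Qed.

Lemma edge_weight_itv e : 0 <= edge_weight e <= 1.
Proof.
rewrite bigmax_ge_id /= edge_weight_le // => v _.
by have /andP[] := pweight_itv (R := R) tau B v.
Qed.

(** An edge whose orbit leaves [pairs_in] is never removed. Otherwise, outside [antipodal], an
    iterate of [te] fixes [e] only if the same power of [tau] fixes each endpoint [v]. The indices
    [r] removing [e] are therefore congruent modulo the length [l] of the cycle of [v]; at most
    [N / l] of them exist, and a proportion at least [1 - 1 / l] keeps [e]. *)
Lemma card_removed e : e \in pairs_in -> e \notin antipodal ->
  edge_weight e <= N%:R^-1 * \sum_(r < N) (e \notin removed r)%:R.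
Proof.
move=> eS eA; have N0 : (0 < N)%N by apply: order_gt0.
have NR : 0 < N%:R :> R by rewrite ltr0n.
rewrite mulrC ler_pdivlMr //.
have [fe|nfe] := boolP (full e); last first.
  rewrite (eq_bigr (fun=> 1)) => [|r _]; last by rewrite inE (negPf nfe).
  rewrite sumr_const card_ord ler_piMl ?ler0n //.
  by have /andP[] := edge_weight_itv e.
have e2 : #|e| = 2%N by move: eS; rewrite inE => /andP[/eqP].
set Q := [set r : 'I_N | iter r te (froot te e) == e]%SET.
have -> : \sum_(r < N) (e \notin removed r)%:R = N%:R - #|Q|%:R :> R.
  apply/eqP; rewrite -subr_eq opprK; apply/eqP.
  rewrite -[#|Q|]sum1_card natr_sum [X in _ + X]big_mkcond -big_split /=.
  rewrite (eq_bigr (fun=> 1)) => [|r _]; first by rewrite sumr_const card_ord.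
  by rewrite !inE fe /=; case: eqP => _; rewrite ?addr0 ?add0r.
rewrite -ler_pdivlMr // mulrBl mulfV ?gt_eqF //.
have hQ v : v \in e -> (#|Q| * #|porbit tau v| <= N)%N.
  move=> ve; set l := #|porbit tau v|.
  have l0 : (0 < l)%N by apply: card_porbit_gt0.
  have lN : (l %| N)%N by apply: expg_fix_dvd; rewrite expg_order perm1.
  have cong (r r' : 'I_N) : r \in Q -> r' \in Q -> (r <= r')%N -> (l %| r' - r)%N.
    rewrite !inE => /eqP er /eqP er' rr'; apply: expg_fix_dvd.
    by apply: (antipodalP e2 eA) => //; rewrite -{1}er -iterD subnK.
  rewrite -leq_divRL // -[X in (_ <= X)%N]card_ord.
  have lt (r : 'I_N) : (r %/ l < N %/ l)%N.
    by rewrite ltn_divLR // divnK.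
  rewrite -(card_in_imset (f := fun r => Ordinal (lt r))); first exact: max_card.
  move=> r r' rQ r'Q [] erl; apply/val_inj => /=.
  rewrite (divn_eq r l) (divn_eq r' l) erl; congr (_ + _)%N.
  case: (leqP r r') => rr'.
    by apply/eqP; rewrite eq_sym eqn_mod_dvd // cong.
  by apply/eqP; rewrite eqn_mod_dvd ?(ltnW rr') // cong // ltnW.
apply: edge_weight_le => [|v ve].
  have [v ve] : exists v, v \in e by apply/set0Pn; rewrite -card_gt0 e2.
  rewrite subr_ge0 ler_pdivrMr // mul1r ler_nat.
  by apply: leq_trans (hQ v ve); rewrite leq_pmulr // card_porbit_gt0.
have vB r : (tau ^+ r)%g v \in B.
  have := fullP r fe; rewrite inE => /andP[_ /fintype.subsetP]; apply.
  by rewrite iter_im; apply: imset_f.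
have sB : porbit tau v \subset B by apply/fintype.subsetP => w /porbitP[i ->].
rewrite /pweight sB -{1}(perm1 v) -(expg0 tau) vB lerD2l lerN2.
rewrite ler_pdivrMr // mulrC ler_pdivlMr ?ltr0n ?card_porbit_gt0 //.
by rewrite -natrM ler_nat hQ.
Qed.

(** A nonempty [S1] inside its own image is stable under [te], so it consists of whole orbits, all
    contained in [pairs_in]; but the [r]-th iterate of the root of such an orbit is removed. *)
Lemma kept_acyclic r : acyclic te (kept r).
Proof.
move=> S1 S1k /set0Pn[e eS1]; apply: contrapT => h.
have S1te : S1 \subset (te @: S1)%SET.
  apply/fintype.subsetP => x xS1; apply: contrapT => /negP nx; apply: h.
  by exists x.
have S1E : S1 = (te @: S1)%SET.
  apply/eqP; rewrite eqEcard S1te card_imset ?leqnn //; exact: te_inj.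
have it i x : x \in S1 -> iter i te x \in S1.
  by elim: i => //= i IH xS1; rewrite S1E; apply: imset_f; apply: IH.
have fl x : x \in S1 -> full x.
  move=> xS1; apply/forallP => i; have := fintype.subsetP S1k _ (it i _ xS1).
  by rewrite !inE => /andP[_ /andP[]].
have cs := fconnect_sym te_inj.
have rS1 : froot te e \in S1.
  by rewrite -(iter_findex (connect_root (frel te) e)); apply: it.
have eS2 := it r _ rS1.
have := fintype.subsetP S1k _ eS2; rewrite !inE fl //= => /andP[/eqP []].
congr (iter r te _); rewrite -(fingraph.rootP cs (fconnect_iter te r _)).
by rewrite root_root.
Qed.

Lemma overlap_moment :
  Ex p (fun g => expR (ln (1 + s) * weighted_overlap g)) <=
  2 ^+ #|T| * (1 + 2 * P ^+ 2 * s) ^+ #|pairs_in|.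
Proof.
have N0 : (0 < N)%N by apply: order_gt0.
have NR : N%:R != 0 :> R by rewrite pnatr_eq0 -lt0n.
have s0 := s_ge0; have hPs := Ps; have s1 : 0 < 1 + s by lra.
have L0 : 0 <= ln (1 + s) by apply: ln_ge0; lra.
have P0 : 0 <= P by have /andP[h /(le_trans h)] := p0P finset.set0.
have p01 i : 0 <= p i <= 1 by have /andP[-> h] := p0P i; rewrite (le_trans h).
have c0 : 0 <= 2 * P ^+ 2 * s by rewrite !mulr_ge0 // exprn_ge0.
(* [F r] counts the pairs of [kept r] and the single antipodal edges, the latter through the initial
   weights [t] of [acyclic_bound]. *)
pose t e : R := if e \in antipodal then s else 0.
pose F (r : nat) (g : {set {set T}}) : R := \prod_(e in kept r) (1 + s * ((e \in g) && (te e \in g))%:R) *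
              \prod_e (1 + t e * (e \in g)%:R).
have FE r : Ex p (F r) <= 2 ^+ #|T| * (1 + 2 * P ^+ 2 * s) ^+ #|pairs_in|.
  apply: le_trans (acyclic_bound te_inj p0P P1 s_ge0 Ps (@kept_acyclic r) _ _ _) _.
  - by move=> e; rewrite /t; case: ifP.
  - by move=> e; rewrite !inE /t inE => /andP[_ /andP[/negPf -> _]]; apply: ler01.
  - move=> _ /imsetP[e eK ->]; rewrite /t ifN //; apply: antipodal_te.
    by move: eK; rewrite finset.in_setD => /andP[_]; rewrite finset.in_setD => /andP[].
  rewrite mulrC; apply: ler_pM.
  - by apply: prodr_ge0 => e _; rewrite addr_ge0 // mulr_ge0 // /t; case: ifP.
  - by rewrite exprn_ge0 // addr_ge0.
  - rewrite (eq_bigr (fun e => if e \in antipodal then 1 + P * s else 1)); last first.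
      by move=> e _; rewrite /t; case: ifP; rewrite ?mulr0 ?addr0.
    rewrite -big_mkcond prodr_const.
    (* Each antipodal edge costs a factor [1 + P * s <= 2]. *)
    apply: (@le_trans _ _ (2 ^+ #|antipodal|)).
      by rewrite lerXn2r ?nnegrE ?addr_ge0 ?mulr_ge0 //; lra.
    by rewrite ler_weXn2l ?card_antipodal //; lra.
  - rewrite ler_weXn2l ?lerDl // subset_leq_card //.
    apply: fintype.subset_trans (subsetDl _ _) _; exact: subsetDl.
(* Pointwise in [g]: by [card_removed] the weighted overlap is at most the mean over [r] of the
   counts in [F r], and Jensen takes the mean out of the exponential. *)
apply: (@le_trans _ _ (Ex p (fun g => N%:R^-1 * \sum_(r < N) F r g))).
  apply: ler_Ex => // g.
  pose z (r : nat) := \sum_(e in kept r) (((e \in g) && (te e \in g))%:R : R).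
  pose a := \sum_(e in antipodal) ((e \in g)%:R : R).
  have zE (r : nat) : F r g = expR (ln (1 + s) * (a + z r)).
    rewrite /F mulrDr expRD mulrC; congr (_ * _).
      rewrite mulr_sumr expR_sum [RHS]big_mkcond; apply: eq_bigr => e _.
      rewrite /t; case: ifP => _; case: (e \in g);
        by rewrite ?mul0r ?mulr0 ?mulr1 ?addr0 ?expR0 ?lnK ?posrE.
    rewrite mulr_sumr expR_sum; apply: eq_bigr => e _.
    by case: (_ && _); rewrite ?mulr0 ?mulr1 ?addr0 ?expR0 ?lnK ?posrE.
  rewrite (eq_bigr (fun r : 'I_N => expR (ln (1 + s) * (a + z r)))) => [|r _]; last exact: zE.
  apply: le_trans (expR_avg _ N0).
  rewrite ler_expR -mulr_sumr mulrCA ler_wpM2l //.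
  rewrite big_split /= sumr_const card_ord -[a *+ _]mulr_natl mulrDr mulrA mulVf // mul1r.
  rewrite /z; under [X in _ + _ * X]eq_bigr do rewrite big_mkcond.
  rewrite exchange_big mulr_sumr /a /weighted_overlap big_mkcond [X in _ <= X + _]big_mkcond -big_split /=.
  apply: ler_sum => e _; set y : R := (_ && _)%:R.
  have y01 : 0 <= y <= 1 by rewrite ler0n lern1 leq_b1.
  have sum0 : 0 <= N%:R^-1 * \sum_(i < N) (if e \in kept i then y else 0).
    rewrite mulr_ge0 ?invr_ge0 ?ler0n // sumr_ge0 // => r _.
    by case: ifP => // _; case/andP: y01.
  have ye : y <= (e \in g)%:R by rewrite /y ler_nat; case: (e \in g) => //=; exact: leq_b1.
  case: (boolP (e \in antipodal)) => eA.
    have /andP[w0 w1] := edge_weight_itv e.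
    have h0 : 0 <= (e \in g)%:R :> R by rewrite ler0n.
    case: ifP => _; last by rewrite addr_ge0.
    rewrite -[leLHS]addr0 lerD // (le_trans _ ye) // ler_piMl //; by case/andP: y01.
  case: ifP => eS; last by rewrite add0r.
  rewrite add0r (eq_bigr (fun r : 'I_N => (e \notin removed r)%:R * y)); last first.
    move=> r _; rewrite finset.in_setD finset.in_setD eA eS andbT.
    by case: (_ \notin _); rewrite ?mul1r ?mul0r.
  rewrite -mulr_suml mulrA ler_wpM2r ?card_removed //; by case/andP: y01.
rewrite ExZ Ex_sum ler_pdivrMl ?ltr0n //.
apply: (@le_trans _ _ (\sum_(r < N) 2 ^+ #|T| * (1 + 2 * P ^+ 2 * s) ^+ #|pairs_in|)).
  by apply: ler_sum => r _; apply: FE.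
by rewrite sumr_const card_ord -[X in X <= _]mulr_natl.
Qed.

End OverlapMoment.

(** * Balanced allocations *)

Section BalancedExists.
Context {R : realType} {n : nat}.
Implicit Types (K : {set {set 'I_n}}) (theta : 'I_n -> 'I_n -> R).

Lemma graph_edge_neq K u v : is_graph K -> [set u; v]%SET \in K -> u != v.
Proof.
move=> /fintype.subsetP gK /gK; rewrite inE cards2.
by case: (eqVneq u v).
Qed.

(** An allocation on the complete graph: the competitors then form a compact cube whatever [K]
    is. *)
Let total theta := forall u v, u != v -> 0 <= theta u v <= 1 /\ theta u v + theta v u = 1.

Let energy K theta : R := \sum_v load K theta v ^+ 2.

Lemma exists_min_energy K : is_graph K ->
  exists theta, total theta /\ forall theta', total theta' -> energy K theta <= energy K theta'.
Proof.
move=> gK.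
(* For an edge only the coordinate with [u < v] is read; the opposite direction receives the
   complementary mass. *)
pose th (w : 'rV[R]_(n * n)) (u v : 'I_n) : R :=
  if (u < v)%N then w ord0 (mxvec_index u v) else 1 - w ord0 (mxvec_index v u).
pose A : set 'rV[R]_(n * n) := [set w : 'rV[R]_(n * n) | (forall i, w ord0 i \in `[0, 1])%R]%classic.
have Aco : compact A.
  exact: (@rV_compact R (n * n) (fun=> `[0, 1]%classic) (fun _ => @segment_compact _ _ _)).
have cth u v : continuous (fun w => th w u v).
  rewrite /th; case: (u < v)%N; first exact: coord_continuous.
  by move=> w; exact: (cvgB (cvg_cst _) (@coord_continuous R _ _ ord0 _ w)).
have cl v : continuous (fun w => load K (th w) v).
  by apply: continuous_big => [|u _]; [exact: add_continuous|exact: cth].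
have cE : continuous (fun w => energy K (th w)).
  apply: continuous_big => [|v _]; first exact: add_continuous.
  by move=> w; exact: (cvgM (cl v w) (cl v w)).
have A0 : (A !=set0)%classic.
  by exists 0 => i /=; rewrite mxE in_itv /= lexx ler01.
have [w wA wmin] := compact_EVT_min A0 Aco (continuous_subspaceT cE).
exists (th w); split.
  move=> u v uv; move: wA; rewrite inE => wA.
  have h i : 0 <= w ord0 i <= 1 by have := wA i; rewrite /= in_itv.
  have h1 := h (mxvec_index u v); have h2 := h (mxvec_index v u).
  rewrite /th; case: (ltngtP u v) => [||/val_inj] e; [| |by rewrite e eqxx in uv].
    by split=> //; lra.
  by split; lra.
move=> th' t'; pose w' : 'rV[R]_(n * n) := mxvec (\matrix_(u, v) (if u == v then 0 else th' u v)).
have -> : energy K th' = energy K (th w').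
  apply: eq_bigr => v _; congr (_ ^+ 2); apply: eq_bigr => u uvK.
  have uv := graph_edge_neq gK uvK.
  rewrite /th /w' !mxvecE !mxE (negPf uv) [v == u]eq_sym (negPf uv).
  by case: ifP => // _; have [_ <-] := t' u v uv; ring.
apply: wmin; rewrite inE => i; case/mxvec_indexP: i => u v.
rewrite /w' mxvecE mxE /= in_itv /=; case: eqVneq => [_|uv]; first by rewrite lexx ler01.
by have [] := t' u v uv.
Qed.

(** A minimiser of the energy is balanced: if an edge sent mass to its more loaded endpoint,
    rerouting a little of it to the other endpoint would lower the sum of the squared loads. *)
Lemma exists_balanced K : is_graph K ->
  exists theta, allocation K theta /\ balanced K theta.
Proof.
move=> gK; have [th [tt tmin]] := exists_min_energy gK; exists th; split.
  by move=> u v uvK; apply: tt; apply: graph_edge_neq gK uvK.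
move=> u v uvK luv; apply/eqP; apply: contraT => thN0.
have uv := graph_edge_neq gK uvK.
have [/andP[t0 t1] ts] := tt u v uv.
have tpos : 0 < th u v by rewrite lt_def thN0.
pose D := load K th v - load K th u.
have D0 : 0 < D by rewrite subr_gt0.
(* Rerouting [dl] changes the energy by [2 * dl * (dl - D)], negative for [dl <= D / 2];
   [dl <= th u v] keeps the masses in the unit interval. *)
pose dl := Num.min (th u v) (D / 2).
have dl0 : 0 < dl by rewrite lt_min tpos divr_gt0.
have dl1 : dl <= th u v by rewrite ge_min lexx.
have dl2 : dl <= D / 2 by rewrite ge_min lexx orbT.
pose th' a b := th a b + dl * (((a == v) && (b == u))%:R - ((a == u) && (b == v))%:R).
have t' : total th'.
  move=> a b ab; have [h1 h2] := tt a b ab.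
  rewrite /th' [(b == v) && _]andbC [(b == u) && _]andbC.
  split; last by rewrite -h2; ring.
  case: (boolP ((a == v) && (b == u))) => [/andP[/eqP ea /eqP eb]|_].
    rewrite ea eb [v == u]eq_sym (negPf uv) /=; rewrite ea eb in h1 h2; lra.
  case: (boolP ((a == u) && (b == v))) => [/andP[/eqP ea /eqP eb]|_].
    rewrite ea eb /=; lra.
  by rewrite subr0 mulr0 addr0.
have lE x : load K th' x = load K th x + dl * ((x == u)%:R - (x == v)%:R).
  rewrite /load /th' big_split -mulr_sumr /=; congr (_ + _ * _).
  rewrite sumrB; congr (_ - _).
    have [->|xu] := eqVneq x u; last by rewrite big1 // => a _; rewrite andbF.
    rewrite (bigD1 v) /=; last by rewrite finset.setUC.
    by rewrite !eqxx /= big1 ?addr0 // => a /andP[_ /negPf ->].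
  have [->|xv] := eqVneq x v; last by rewrite big1 // => a _; rewrite andbF.
  by rewrite (bigD1 u) //= !eqxx /= big1 ?addr0 // => a /andP[_ /negPf ->].
have := tmin _ t'; rewrite leNgt => /negP[].
rewrite /energy (bigD1 u) //= (bigD1 v) /=; last by rewrite eq_sym.
rewrite [ltRHS](bigD1 u) //= [X in _ < _ + X](bigD1 v) /=; last by rewrite eq_sym.
rewrite !lE !eqxx (negPf uv) [v == u]eq_sym (negPf uv) /=.
rewrite (eq_bigr (fun i => load K th i ^+ 2)); last first.
  by move=> i /andP[/negPf iu /negPf iv]; rewrite lE iu iv subrr mulr0 addr0.
rewrite !addrA ltrD2r.
have : dl * dl <= dl * (D / 2) by rewrite ler_wpM2l // ltW.
have : 0 < dl * D by rewrite mulr_gt0.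
rewrite /D; nra.
Qed.

Lemma balanced_loadP K : is_graph K ->
  exists theta, [/\ allocation K theta, balanced K theta & balanced_load K = load K theta].
Proof.
move=> gK; have [th [h1 h2]] := exists_balanced gK.
rewrite /balanced_load; case: xgetP => [t et [a b]|nP].
  by exists t; split=> //; rewrite et.
by case: (nP th); split.
Qed.
End BalancedExists.

Section EdgeSums.
Context {R : nmodType} {n : nat}.
Implicit Types (S : {set {set 'I_n}}) (f : 'I_n -> 'I_n -> R).

Lemma set2_eqE (a b u v : 'I_n) : a != b ->
  ([set u; v]%SET == [set a; b]%SET) = ((u, v) == (a, b)) || ((u, v) == (b, a)).
Proof.
move=> ab; rewrite !xpair_eqE; apply/eqP/orP => [e|[] /andP[/eqP-> /eqP->]//]; last first.
  exact: finset.setUC.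
have : (a \in [set u; v]%SET) && (b \in [set u; v]%SET) by rewrite e set21 set22.
rewrite !inE => /andP[/orP[] /eqP ea /orP[] /eqP eb].
- by rewrite ea eb eqxx in ab.
- by rewrite ea eb !eqxx; left.
- by rewrite ea eb !eqxx; right.
- by rewrite ea eb eqxx in ab.
Qed.

Lemma sum_edges S f :
  \sum_v \sum_(u | [set u; v]%SET \in S) f u v =
  \sum_(e in S) \sum_(uv | [set uv.1; uv.2]%SET == e) f uv.1 uv.2.
Proof.
rewrite pair_big_dep /= (reindex_inj (h := fun uv : 'I_n * 'I_n => (uv.2, uv.1))) /=; last first.
  by move=> [a b] [c d] [-> ->].
rewrite (partition_big (fun uv => [set uv.1; uv.2]%SET) (mem S)) /=; last by [].
apply: eq_bigr => e eS; apply: eq_bigl => uv.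
by case: eqP => [->|]; rewrite ?andbF // eS.
Qed.

Lemma sum_pair (a b : 'I_n) f : a != b ->
  \sum_(uv | [set uv.1; uv.2]%SET == [set a; b]%SET) f uv.1 uv.2 = f a b + f b a.
Proof.
move=> ab; rewrite (bigD1 (a, b)) //= (bigD1 (b, a)) /=; last first.
  by rewrite finset.setUC eqxx xpair_eqE negb_and ab orbT.
rewrite big1 ?addr0 // => -[u v]; rewrite set2_eqE // => /andP[/andP[]].
by case/orP => ->; rewrite ?andbF.
Qed.

Lemma graph_edgeP S e : is_graph S -> e \in S -> exists a b, a != b /\ e = [set a; b]%SET.
Proof.
move=> /fintype.subsetP gS /gS; rewrite inE => /cards2P[a [b [ab eE]]].
by exists a, b.
Qed.
End EdgeSums.

(** * Certificates of a large overlap load *)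

Lemma overlap_graph n (s : 'S_n) (K : {set {set 'I_n}}) :
  is_graph K -> is_graph (overlap s K K).
Proof. by move=> gK; apply: fintype.subset_trans gK; apply: subsetIr. Qed.

Lemma overlapP n (s : 'S_n) (K : {set {set 'I_n}}) e :
  (e \in overlap s K K) = (e \in K) && ((s^-1)%g @: e \in K)%SET.
Proof.
rewrite inE andbC; congr (_ && _).
have sK (e' : {set 'I_n}) : ((s^-1)%g @: (s @: e') = e')%SET.
  by rewrite -imset_comp (eq_imset (g := id)) ?imset_id // => x /=; rewrite permK.
apply/imsetP/idP => [[e' e'K ->]|h]; first by rewrite sK.
exists ((s^-1)%g @: e)%SET => //.
by rewrite -imset_comp (eq_imset (g := id)) ?imset_id // => x /=; rewrite permKV.
Qed.

(* [B] is the set of vertices of load at least [x]. An edge leaving [B] gives its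
   whole mass to its endpoint outside [B], so the load of [B] comes from edges
   inside [B], on which [tau] agrees with [s^-1]. *)
Lemma overlap_certificate (R : realType) n (K : {set {set 'I_n}}) (s : 'S_n)
    (A : {set 'I_n}) (x : R) :
  is_graph K -> A \subset Der s -> 0 <= x ->
  (forall v, v \in A -> x <= balanced_load (overlap s K K) v) ->
  exists B (tau : 'S_n), #|A|%:R / 2 <= (prank tau)%:R :> R /\
    x * (prank tau)%:R <= weighted_overlap tau B K.
Proof.
move=> gK AD x0 hA; have gH := overlap_graph s gK.
have [th [al ba lE]] := balanced_loadP (R := R) gH.
set H := overlap s K K in gH al ba lE hA.
pose B := [set v | x <= load H th v]%SET.
have [tau [tauB tau1]] := exists_prank_min s^-1%g B.
exists B, tau; split.
  apply: prank_support => v vA.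
  have vB : v \in B by rewrite inE -lE hA.
  rewrite tauB //; have := fintype.subsetP AD _ vA; rewrite inE; apply: contra => /eqP e.
  by rewrite -{1}e permKV.
(* Vertices outside [B] have weight 0, vertices of [B] have load at least [x]. *)
apply: (@le_trans _ _ (\sum_v pweight tau B v * load H th v)).
  apply: (@le_trans _ _ (x * \sum_v pweight tau B v)).
    by rewrite ler_wpM2l // prank_pweight.
  rewrite mulr_sumr; apply: ler_sum => v _; rewrite mulrC.
  have [vB|vB] := boolP (v \in B); last by rewrite /pweight (negPf vB) !mul0r.
  rewrite ler_wpM2l //; first by have /andP[] := pweight_itv (R := R) tau B v.
  by move: vB; rewrite inE.
rewrite (eq_bigr (fun v => \sum_(u | [set u; v]%SET \in H) pweight tau B v * th u v)); last first.
  by move=> v _; rewrite /load mulr_sumr.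
rewrite (sum_edges H (fun u v => pweight tau B v * th u v)) /weighted_overlap big_mkcond [leRHS]big_mkcond.
apply: ler_sum => e _.
have rhs0 : 0 <= (if e \in pairs_in B then
    edge_weight tau B e * ((e \in K) && ((tau @: e)%SET \in K))%:R else 0 : R).
  case: ifP => // _; rewrite mulr_ge0 ?ler0n //.
  by have /andP[] := edge_weight_itv (R := R) tau B e.
case: ifP => [eH|//].
have [a [b [ab eE]]] := graph_edgeP gH eH.
rewrite {1}eE (sum_pair (fun u v => pweight tau B v * th u v) ab).
have abH : [set a; b]%SET \in H by rewrite -eE.
have baH : [set b; a]%SET \in H by rewrite finset.setUC.
have [/andP[t0 t1] ts] := al _ _ abH.
have nB u v : [set u; v]%SET \in H -> u \notin B -> pweight tau B v * th u v = 0.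
  move=> uvH; rewrite inE -ltNge => ux.
  have [vB|vB] := boolP (v \in B); last by rewrite /pweight (negPf vB) mul0r.
  by rewrite (ba _ _ uvH) ?mulr0 // (lt_le_trans ux) //; move: vB; rewrite inE.
have nB' u v : v \notin B -> pweight tau B v * th u v = 0.
  by move=> vB; rewrite /pweight (negPf vB) mul0r.
have [aB|aB] := boolP (a \in B); last by rewrite (nB a b) // (nB' b a) // addr0.
have [bB|bB] := boolP (b \in B); last by rewrite (nB b a) // (nB' a b) // addr0.
have eB : e \subset B by apply/fintype.subsetP => v; rewrite eE => /set2P[]->.
rewrite inE eB eE cards2 ab /=.
have teE : (tau @: [set a; b] = s^-1%g @: [set a; b])%SET.
  by apply: eq_in_imset => v; rewrite !inE => /orP[] /eqP->; apply: tauB.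
rewrite teE -overlapP -/H abH mulr1.
have wa : pweight tau B a <= edge_weight tau B [set a; b]%SET :> R.
  by apply: edge_weight_ge; rewrite !inE eqxx.
have wb : pweight tau B b <= edge_weight tau B [set a; b]%SET :> R.
  by apply: edge_weight_ge; rewrite !inE eqxx orbT.
have -> : th b a = 1 - th a b by rewrite -ts; ring.
move: (edge_weight _ _ _) wa wb => w wa wb.
have : pweight tau B b * th a b <= w * th a b by rewrite ler_wpM2r.
have : pweight tau B a * (1 - th a b) <= w * (1 - th a b) by rewrite ler_wpM2r ?subr_ge0.
lra.
Qed.

(** * Union bound over the certificates *)

Section CertificateBound.
Context {R : realType} {T : finType}.
Variables (p : {set T} -> R) (P s x eps : R).
Hypotheses (p0P : forall e, 0 <= p e <= P).
Hypotheses (P1 : P <= 1) (s_ge0 : 0 <= s) (Ps : P * s <= 1 / 2).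
Let n := #|T|.
Let rho : R := n%:R * expR (- (ln (1 + s) * x)).
Hypotheses (n_gt0 : (0 < n)%N) (rho_le1 : rho <= 1) .

Lemma card_pairs_in (B : {set T}) : (#|pairs_in B| <= n * n)%N.
Proof.
apply: (@leq_trans 'C(n, 2)).
  rewrite /n -card_draws; apply: subset_leq_card; apply/fintype.subsetP => e.
  by rewrite !inE => /andP[].
by rewrite bin2 -divn2 (leq_trans (leq_div _ _)) // leq_mul2l leq_pred orbT.
Qed.

(** Markov's inequality for the exponential moment, then a union bound. Each [tau] brings
    [n ^ - prank tau], summable by [sum_prank], times [rho ^+ prank tau], small because [prank tau]
    is at least [eps * n / 2]. The constant 8 is the product of a factor 2 for the choice of [B],
    one from [overlap_moment] and one from [sum_prank]. *)
Lemma certificate_bound :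
  Ex p (fun g => [exists B : {set T}, exists tau : {perm T},
     (eps * n%:R / 2 <= (prank tau)%:R :> R) &&
     (x * (prank tau)%:R <= weighted_overlap tau B g :> R)]%:R) <=
  (8 * expR (2 * n%:R * P ^+ 2 * s) * rho `^ (eps / 2)) ^+ n.
Proof.
have p01 i : 0 <= p i <= 1 by have /andP[-> h] := p0P i; rewrite (le_trans h).
have s0 := s_ge0.
have L0 : 0 <= ln (1 + s) by apply: ln_ge0; lra.
have nR : 0 < n%:R :> R by rewrite ltr0n.
have rho0 : 0 < rho by rewrite mulr_gt0 ?expR_gt0.
have P0 : 0 <= P by have /andP[h /(le_trans h)] := p0P finset.set0.
have c0 : 0 <= 2 * P ^+ 2 * s by rewrite !mulr_ge0.
pose G (B : {set T}) (tau : {perm T}) (g : {set {set T}}) : R :=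
  expR (- (ln (1 + s) * (x * (prank tau)%:R))) * expR (ln (1 + s) * weighted_overlap tau B g).
pose Q (tau : {perm T}) := eps * n%:R / 2 <= (prank tau)%:R :> R.
apply: (@le_trans _ _ (Ex p (fun g => \sum_B \sum_(tau | Q tau) G B tau g))).
  apply: ler_Ex => // g.
  have G0 B tau : 0 <= G B tau g by rewrite mulr_ge0 ?expR_ge0.
  case: (boolP [exists B, _]) => [/existsP[B /existsP[tau /andP[Qt xt]]]|_]; last first.
    by rewrite sumr_ge0 // => B _; rewrite sumr_ge0.
  rewrite (bigD1 B) //= (bigD1 tau) //= -addrA -[leLHS]addr0 lerD //.
    rewrite /G -expRD -[leLHS]expR0 ler_expR.
    by rewrite addrC subr_ge0 ler_wpM2l.
  by rewrite addr_ge0 ?sumr_ge0 // => B' _; rewrite sumr_ge0.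
rewrite Ex_sum.
pose M : R := 2 ^+ n * expR (2 * n%:R * P ^+ 2 * s) ^+ n.
have hM B tau : Ex p (G B tau) <= (n%:R^-1) ^+ prank tau * rho ^+ prank tau * M.
  rewrite /G ExZ; apply: ler_pM; rewrite ?expR_ge0 //.
  - by apply: sumr_ge0 => g _; rewrite mulr_ge0 ?expR_ge0 // prodmu_ge0.
  - have e : n%:R^-1 * rho = expR (- (ln (1 + s) * x)).
      by rewrite /rho mulrA mulVf ?mul1r // gt_eqF.
    by rewrite -exprMn e -expRM_natr mulrA mulNr.
  apply: le_trans (overlap_moment tau B p0P P1 s_ge0 Ps) _.
  rewrite /M -/n ler_wpM2l ?exprn_ge0 //.
  apply: (@le_trans _ _ ((1 + 2 * P ^+ 2 * s) ^+ (n * n))).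
    by rewrite ler_weXn2l ?lerDl // card_pairs_in.
  rewrite exprM lerXn2r ?nnegrE ?exprn_ge0 ?expR_ge0 ?addr_ge0 //.
  have -> : 2 * n%:R * P ^+ 2 * s = (2 * P ^+ 2 * s) * n%:R by ring.
  by rewrite expRM_natr lerXn2r ?nnegrE ?expR_ge0 ?addr_ge0 // expR_ge1Dx.
have hQ tau : Q tau -> rho ^+ prank tau <= (rho `^ (eps / 2)) ^+ n.
  move=> Qt; rewrite -powR_mulrn ?(ltW rho0) // -powR_mulrn ?powR_ge0 // -powRrM.
  have rE a : rho `^ a = expR (a * ln rho) by rewrite /powR gt_eqF.
  rewrite !rE ler_expR.
  have lr : ln rho <= 0 by rewrite ln_le0.
  by apply: ler_wnM2r => //; rewrite -mulrA [_^-1 * _]mulrC mulrA.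
apply: (@le_trans _ _ (\sum_(B : {set T}) (rho `^ (eps / 2)) ^+ n * M * 2 ^+ n)).
  apply: ler_sum => B _; rewrite Ex_sum.
  apply: (@le_trans _ _ (\sum_(tau : {perm T}) (n%:R^-1) ^+ prank tau * ((rho `^ (eps / 2)) ^+ n * M))).
    rewrite [leRHS](bigID Q) /= -[leLHS]addr0 lerD //.
      apply: ler_sum => tau Qt; apply: le_trans (hM B tau) _.
      rewrite -mulrA ler_wpM2l ?exprn_ge0 ?invr_ge0 ?ler0n //.
      rewrite ler_wpM2r ?mulr_ge0 ?exprn_ge0 ?expR_ge0 //.
      exact: hQ.
    by apply: sumr_ge0 => tau _; rewrite !mulr_ge0 ?exprn_ge0 ?expR_ge0 ?invr_ge0 ?ler0n ?powR_ge0.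
  rewrite -mulr_suml mulrC ler_wpM2l ?mulr_ge0 ?exprn_ge0 ?expR_ge0 ?powR_ge0 //.
  exact: sum_prank.
rewrite sumr_const -cardsT -powersetT card_powerset cardsT -/n -[leLHS]mulr_natl natrX /M.
have -> : (8 : R) = 2 * 2 * 2 by ring.
by rewrite !exprMn le_eqVlt; apply/orP; left; apply/eqP; ring.
Qed.
End CertificateBound.

(** * Upper bound *)

Section GraphLaw.
Context {R : realType} (d : measure_display) (T : measurableType d).
Variables (P : probability T R) (n : nat) (K : T -> {set {set 'I_n}}).

Lemma measurable_graph_event (Q : pred {set {set 'I_n}}) : random_graph K ->
  measurable [set t | Q (K t)]%classic.
Proof.
move=> [_ mK].
have -> : [set t | Q (K t)]%classic =
    (\bigcup_(g in [set g | Q g]) [set t | K t = g])%classic.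
  by apply/seteqP; split => [t Qt|t [g Qg /= e]]; [exists (K t)|rewrite e].
by apply: fin_bigcup_measurable => //; exact: finite_finset.
Qed.

Lemma prob_graph_event (Q : pred {set {set 'I_n}}) : random_graph K ->
  P [set t | Q (K t)]%classic = (\sum_(g | Q g) P [set t | K t = g]%classic)%E.
Proof.
move=> [_ mK].
have -> : [set t | Q (K t)]%classic =
    (\bigcup_(g in [set g | Q g]) [set t | K t = g])%classic.
  by apply/seteqP; split => [t Qt|t [g Qg /= e]]; [exists (K t)|rewrite e].
rewrite measure_fin_bigcup //; last 2 first.
- exact: finite_finset.
- by apply/trivIsetP => g1 g2 _ _ g12; apply/seteqP; split => // t [/= e1 e2]; rewrite -e1 -e2 eqxx in g12.
rewrite (@fsbigE _ _ _ _ _ (enum Q)) ?enum_uniq //.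
- rewrite big_enum_cond /=; apply: eq_bigl => g.
  by apply/andP/idP => [[]//|Qg]; split => //; rewrite inE.
- by move=> g /=; rewrite mem_enum.
- by move=> g /= Qg; rewrite mem_enum => /negP[].
Qed.

(** The value 0 concentrates the product measure over all sets of vertices on the graphs. *)
Definition edge_prob (p : R) (e : {set 'I_n}) : R := if e \in pairs n then p else 0.

(** Every event is a finite union of atoms. The atom of a graph is an intersection of independent
    events, one per pair; any other atom has measure 0 on both sides. *)
Lemma graph_law (p : R) (Q : pred {set {set 'I_n}}) : erdos_renyi P p K ->
  P [set t | Q (K t)]%classic = (Ex (edge_prob p) (fun g => (Q g)%:R))%:E.
Proof.
move=> [rK eK iK]; rewrite prob_graph_event //.
rewrite /Ex [in RHS](bigID Q) /= [X in _ = (_ + X)%:E]big1 ?addr0 => [|g /negPf ->]; last by rewrite mulr0.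
rewrite -sumEFin; apply: eq_bigr => g ->; rewrite mulr1.
have me e : measurable [set t | e \in K t]%classic.
  exact: (@measurable_graph_event (fun g => e \in g)).
have [gp|/subsetPn[e eg ep]] := boolP (g \subset pairs n); last first.
  rewrite /prodmu (bigD1 e) //= eg /edge_prob (negPf ep) mul0r.
  rewrite (_ : [set t | K t = g]%classic = set0) ?measure0 //.
  apply/seteqP; split => // t /= e2; case/negP: ep.
  by apply: (fintype.subsetP (rK.1 t)); rewrite e2.
have -> : [set t | K t = g]%classic =
    [set t | forall e, e \in pairs n -> (e \in K t) = (e \in g)]%classic.
  apply/seteqP; split => [t /= -> //|t /= h]; apply/setP => e.
  have [/h //|ep] := boolP (e \in pairs n).
  rewrite [in LHS](contraNF (fintype.subsetP (rK.1 t) e) ep).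
  by rewrite (contraNF (fintype.subsetP gp e) ep).
rewrite (iK (pairs n) (fun e => e \in g)) ?fintype.subxx //.
rewrite /prodmu [in RHS](bigID (mem (pairs n))) /= [X in _ = (_ * X)%:E]big1 ?mulr1; last first.
  move=> e ep; rewrite (contraNF (fintype.subsetP gp e) ep) /edge_prob (negPf ep).
  by rewrite subr0.
rewrite -prodEFin; apply: eq_bigr => e ep; rewrite /edge_prob ep.
case: (e \in g); first exact: eK.
rewrite -[RHS]/(1%:E - p%:E)%E -(eK e ep).
rewrite -probability_setC //; congr (P _); apply/seteqP; split => t /=.
  by move=> ->.
by move/negP/negPf.
Qed.
End GraphLaw.

Lemma powR_infty (R : realType) (b C : R) : 0 < b ->
  \forall n \near \oo, C <= n%:R `^ b.
Proof.
move=> b0; near=> n.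
have [C0|C0] := leP C 0; first exact: le_trans C0 (powR_ge0 _ _).
have CE : C = (C `^ b^-1) `^ b by rewrite -powRrM mulVf ?powRr1 ?(ltW C0) ?lt0r_neq0.
rewrite [leLHS]CE.
rewrite ge0_ler_powR ?nnegrE ?powR_ge0 ?ler0n ?(ltW b0) //.
near: n; exact: nbhs_infty_ger.
Unshelve. all: by end_near. Qed.

Lemma max_overlap_load_geP (R : realType) n (eps x : R) (K : {set {set 'I_n}}) :
  (x%:E <= max_overlap_load eps K)%E <->
  exists (s : 'S_n) (A : {set 'I_n}), [/\ A \subset Der s, eps * n%:R <= #|A|%:R &
    forall v, v \in A -> x <= balanced_load (overlap s K K) v].
Proof.
rewrite /max_overlap_load; split.
  move=> /bigmax_geP[//|[s _ /bigmax_geP[//|[A /andP[AD eA] /bigmin_geP[_ h]]]]].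
  by exists s, A; split => // v vA; have := h v vA; rewrite lee_fin.
move=> [s [A [AD eA h]]]; apply/bigmax_geP; right; exists s => //.
apply/bigmax_geP; right; exists A; first by rewrite AD.
by apply/bigmin_geP; split; [rewrite leey|move=> v vA; rewrite lee_fin h].
Qed.

Lemma upper_tail_bound (R : realType) (d : measure_display) (T : measurableType d)
    (P : probability T R) (n : nat) (K : T -> {set {set 'I_n}}) (p s x eps : R) :
  (0 < n)%N -> 0 <= p <= 1 -> erdos_renyi P p K -> 0 <= s -> p * s <= 1 / 2 -> 0 <= x ->
  n%:R * expR (- (ln (1 + s) * x)) <= 1 ->
  (P [set t | (x%:E <= max_overlap_load eps (K t))%E]%classic <=
   ((8 * expR (2 * n%:R * p ^+ 2 * s) *
     (n%:R * expR (- (ln (1 + s) * x))) `^ (eps / 2)) ^+ n)%:E)%E.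
Proof.
move=> n0 /andP[p0 p1] eK s0 ps x0 rho1.
pose Q (g : {set {set 'I_n}}) := [exists B : {set 'I_n}, exists tau : 'S_n,
     (eps * n%:R / 2 <= (prank tau)%:R :> R) &&
     (x * (prank tau)%:R <= weighted_overlap tau B g :> R)].
have [rK _ _] := eK.
apply: (@le_trans _ _ (P [set t | Q (K t)]%classic)).
  apply: le_measure; rewrite ?inE.
  - exact: (@measurable_graph_event _ _ _ _ (fun g => x%:E <= max_overlap_load eps g)%E).
  - exact: measurable_graph_event.
  - move=> t /= /max_overlap_load_geP[sg [A [AD eA h]]].
    have [B [tau [h1 h2]]] := overlap_certificate (rK.1 t) AD x0 h.
    apply/existsP; exists B; apply/existsP; exists tau; rewrite h2 andbT.
    by apply: le_trans h1; rewrite ler_wpM2r.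
rewrite (graph_law Q eK) lee_fin.
have p0P (e : {set 'I_n}) : 0 <= edge_prob p e <= p.
  by rewrite /edge_prob; case: ifP => _; rewrite ?lexx ?p0 //.
have := certificate_bound (T := 'I_n) (x := x) eps p0P p1 s0 ps.
by rewrite card_ord; apply.
Qed.

Lemma upper_tail_cvg (R : realType) (lambda alpha x eps : R)
    (d : nat -> measure_display) (T : forall n : nat, measurableType (d n))
    (P : forall n : nat, probability (T n) R)
    (K : forall n : nat, T n -> {set {set 'I_n}}) :
  0 < lambda -> 1 / 2 < alpha <= 1 ->
  (forall n : nat, lambda / n%:R `^ alpha <= 1 ->
            erdos_renyi (P n) (lambda / n%:R `^ alpha) (K n)) ->
  0 < eps -> 1 / (2 * alpha - 1) < x ->
  (P n [set t | (x%:E <= max_overlap_load eps (K n t))%E]%classic @[n --> \oo] --> 0%E)%classic.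
Proof.
move=> l0 /andP[ha1 ha2] hK e0 hx.
have a21 : 0 < 2 * alpha - 1 by lra.
have x0 : 0 < x by apply: lt_trans hx; rewrite divr_gt0.
(* [rho] will be at most of order [n ^ - b]. *)
have b0 : 0 < (2 * alpha - 1) * x - 1.
  by move: hx; rewrite ltr_pdivrMr // => hx; rewrite subr_gt0 mulrC.
set b := _ - 1 in b0.
(* Chosen so that [rho <= r0] makes the base of the tail bound at most [1 / 2]. *)
pose r0 : R := (16 * expR lambda)^-1 `^ (2 / eps).
have E0 : 0 < 16 * expR lambda by rewrite mulr_gt0 ?expR_gt0.
have r00 : 0 < r0 by rewrite powR_gt0 // invr_gt0.
apply: (@squeeze_cvge _ _ _ _ (fun=> 0%E) _ (fun n => ((2^-1 : R) ^+ n)%:E)); last 2 first.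
- exact: cvg_cst.
- apply/fine_cvgP; split; first exact: nearW.
  by apply: cvg_expr; rewrite ger0_norm; lra.
near=> n; rewrite measure_ge0 /=.
have n0 : (0 < n)%N by near: n; exact: nbhs_infty_gt.
have nR : 0 < n%:R :> R by rewrite ltr0n.
have na0 : 0 < n%:R `^ alpha by rewrite powR_gt0.
pose p := lambda / n%:R `^ alpha.
have p0 : 0 < p by rewrite divr_gt0.
have p1 : p <= 1.
  rewrite ler_pdivrMr // mul1r; near: n; apply: powR_infty; lra.
(* The largest order for which [2 * n * p ^+ 2 * s] stays bounded: here it equals [lambda], while
   [p * s] is [n ^ (alpha - 1) / 2]. *)
pose s := n%:R `^ (2 * alpha - 1) / (2 * lambda).
have s0 : 0 < s by rewrite divr_gt0 ?powR_gt0 // mulr_gt0.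
have psE : p * s = n%:R `^ (alpha - 1) / 2.
  rewrite /p /s (_ : 2 * alpha - 1 = alpha + (alpha - 1)); last by ring.
  rewrite powRD ?(gt_eqF nR) ?implybT //; field.
  by rewrite (gt_eqF l0) (gt_eqF na0).
have ps : p * s <= 1 / 2.
  rewrite psE ler_pM2r ?invr_gt0 //.
  rewrite -[leRHS](powRr0 n%:R).
  by rewrite ler_powR ?ler1n //; lra.
have E1 : 2 * n%:R * p ^+ 2 * s = lambda.
  have -> : 2 * n%:R * p ^+ 2 * s = 2 * (p * s) * (p * n%:R) by ring.
  rewrite psE /p.
  have -> : 2 * (n%:R `^ (alpha - 1) / 2) * (lambda / n%:R `^ alpha * n%:R) =
     lambda * (n%:R `^ (alpha - 1) * n%:R / n%:R `^ alpha) by field; rewrite gt_eqF.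
  rewrite -{2}(powRr1 (ltW nR)) -powRD ?(gt_eqF nR) ?implybT // subrK mulfV ?mulr1 //.
  by rewrite gt_eqF.
pose rho := n%:R * expR (- (ln (1 + s) * x)).
have rho0 : 0 < rho by rewrite mulr_gt0 ?expR_gt0.
have rhoE : rho <= (2 * lambda) `^ x / n%:R `^ b.
  have sx : s `^ x <= expR (ln (1 + s) * x).
    rewrite /powR (gt_eqF s0) ler_expR mulrC ler_wpM2r ?(ltW x0) // ler_ln ?posrE //; lra.
  have -> : n%:R `^ b = n%:R `^ ((2 * alpha - 1) * x) / n%:R.
    by rewrite /b powRD ?(gt_eqF nR) ?implybT // powR_inv1 // ?(ltW nR).
  have -> : (2 * lambda) `^ x / (n%:R `^ ((2 * alpha - 1) * x) / n%:R) = n%:R / s `^ x.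
    rewrite /s [(_ / _) `^ x]powRM ?powR_ge0 ?invr_ge0 ?mulr_ge0 ?(ltW l0) //.
    have h1 : (2 * lambda) `^ x != 0 by rewrite gt_eqF // powR_gt0 // mulr_gt0.
    have -> : (2 * lambda)^-1 `^ x = ((2 * lambda) `^ x)^-1.
      apply: (mulfI h1); rewrite -powRM ?mulr_ge0 ?invr_ge0 ?mulr_ge0 ?(ltW l0) //.
      by rewrite !mulfV ?powR1 // mulf_neq0 ?lt0r_neq0.
    rewrite -powRrM.
    have h2 : n%:R `^ ((2 * alpha - 1) * x) != 0 :> R by rewrite gt_eqF // powR_gt0.
    by field; rewrite h1 h2 gt_eqF.
  rewrite /rho expRN ler_wpM2l ?ler0n // lef_pV2 ?posrE ?expR_gt0 // powR_gt0 //.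
have rhoC (c : R) : 0 < c -> (2 * lambda) `^ x / c <= n%:R `^ b -> rho <= c.
  move=> c0 h; apply: le_trans rhoE _; rewrite ler_pdivrMr ?powR_gt0 //.
  by rewrite [leRHS]mulrC -ler_pdivrMr.
have rho1 : rho <= 1 by apply: rhoC => //; near: n; exact: powR_infty.
have rhor : rho <= r0 by apply: rhoC => //; near: n; exact: powR_infty.
have pp : 0 <= p <= 1 by rewrite (ltW p0).
apply: le_trans (upper_tail_bound eps n0 pp (hK n p1) (ltW s0) ps (ltW x0) rho1) _.
rewrite lee_fin E1 -/rho lerXn2r ?nnegrE ?mulr_ge0 ?expR_ge0 ?powR_ge0 ?invr_ge0 //.
have : rho `^ (eps / 2) <= (16 * expR lambda)^-1.
  have -> : (16 * expR lambda)^-1 = r0 `^ (eps / 2).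
    rewrite /r0 -powRrM (_ : 2 / eps * (eps / 2) = 1) ?powRr1 ?invr_ge0 ?(ltW E0) //.
    by field; rewrite gt_eqF.
  by rewrite ge0_ler_powR ?nnegrE ?powR_ge0 ?(ltW rho0) ?divr_ge0 ?(ltW e0).
move=> /(ler_wpM2l (_ : 0 <= 8 * expR lambda)) h.
apply: le_trans (h _) _; first by rewrite mulr_ge0 ?expR_ge0.
rewrite le_eqVlt; apply/orP; left; apply/eqP; field.
by rewrite gt_eqF ?expR_gt0.
Unshelve. all: by end_near. Qed.

(** * Packings of gadgets *)

(* A gadget is a graph on the coordinates [C] with oriented edge set [D]. A
   placement sends the coordinate [c] into [Part c]. The coordinates in [U] come in
   two copies exchanged by [sw]; the others (the seeds) are fixed by [sw] and may
   be shared by several placements. *)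
Section Gadget.
Context {C : finType} {n : nat}.
Variables (U : {set C}) (sw : C -> C) (D : {set C * C}) (Part : C -> {set 'I_n}).
Hypotheses (swK : involutive sw) (sw_out : forall c, c \notin U -> sw c = c)
  (sw_in : forall c, c \in U -> sw c \in U /\ sw c != c).
Hypotheses (D_tail : forall a b, (a, b) \in D -> a \in U)
  (D_anti : forall a b, (a, b) \in D -> (b, a) \notin D)
  (D_sw : forall a b, (a, b) \in D -> (sw a, sw b) \in D).
Hypothesis Part_inj : forall c c' v, v \in Part c -> v \in Part c' -> c = c'.

Implicit Types (gam : {ffun C -> 'I_n}) (g : {set {set 'I_n}}) (F : {set {ffun C -> 'I_n}}).

Definition placement gam := gam \in family (fun c => mem (Part c)).

Lemma placementP gam c : placement gam -> gam c \in Part c.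
Proof. by move=> /familyP/(_ c). Qed.

Lemma placement_coord gam gam' c c' :
  placement gam -> placement gam' -> gam c = gam' c' -> c = c'.
Proof.
move=> hg hg' e; apply: (Part_inj (v := gam c)); first exact: placementP.
by rewrite e; apply: placementP.
Qed.

Definition gedge (gam : {ffun C -> 'I_n}) (d : C * C) : {set 'I_n} := [set gam d.1; gam d.2]%SET.

Definition present gam g := [forall d in D, gedge gam d \in g].

Lemma presentP gam g d : present gam g -> d \in D -> gedge gam d \in g.
Proof. by move=> /forall_inP; apply. Qed.

Lemma D_neq a b : (a, b) \in D -> a != b.
Proof.
by move=> abD; apply/eqP => e; move: (D_anti abD); rewrite e in abD *; rewrite abD.
Qed.

Lemma gedge_neq gam a b : placement gam -> (a, b) \in D -> gam a != gam b.
Proof.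
move=> hg /D_neq; apply: contraNneq => e.
by apply/eqP; apply: placement_coord e.
Qed.

(** A vertex determines its coordinate, the parts being disjoint; a match with reversed orientation
    is excluded by [D_anti]. *)
Lemma gedge_inj gam gam' d d' : placement gam -> placement gam' -> d \in D -> d' \in D ->
  gedge gam d = gedge gam' d' -> [/\ d = d', gam d.1 = gam' d.1 & gam d.2 = gam' d.2].
Proof.
case: d d' => [a b] [a' b'] hg hg' dD dD' /= /eqP.
rewrite eq_sym set2_eqE ?gedge_neq // !xpair_eqE /= => /orP[] /andP[/eqP e1 /eqP e2].
  have ea := placement_coord hg' hg e1; have eb := placement_coord hg' hg e2.
  by move: e1 e2; rewrite ea eb.
have ea := placement_coord hg' hg e1; have eb := placement_coord hg' hg e2.
by move: (D_anti dD); rewrite -ea -eb dD'.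
Qed.

Definition gdisjoint F := [forall gam in F, forall gam' in F,
  (gam != gam') ==> [forall c in U, gam c != gam' c]].

Definition packing g F := [&& F \subset [set gam | placement gam & present gam g]%SET & gdisjoint F].

Definition covered F : {set 'I_n} := ((fun p : {ffun C -> 'I_n} * C => p.1 p.2) @: finset.setX F U)%SET.

Lemma coveredP F v : reflect (exists gam c, [/\ gam \in F, c \in U & v = gam c]) (v \in covered F).
Proof.
apply: (iffP imsetP) => [[[gam c]]|[gam [c [h1 h2 ->]]]].
  by rewrite finset.in_setX => /andP[h1 h2] ->; exists gam, c.
by exists (gam, c) => //; rewrite finset.in_setX h1.
Qed.

Section Packing.
Variables (g : {set {set 'I_n}}) (F : {set {ffun C -> 'I_n}}).
Hypothesis hF : packing g F.

Lemma pack_place gam : gam \in F -> placement gam.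
Proof. by case/andP: hF => /fintype.subsetP h _ /h; rewrite inE => /andP[]. Qed.

Lemma pack_present gam : gam \in F -> present gam g.
Proof. by case/andP: hF => /fintype.subsetP h _ /h; rewrite inE => /andP[]. Qed.

Lemma pack_inj gam gam' c c' : gam \in F -> gam' \in F -> c \in U ->
  gam c = gam' c' -> gam = gam' /\ c = c'.
Proof.
move=> gF gF' cU e; have ec := placement_coord (pack_place gF) (pack_place gF') e.
split => //; apply/eqP; apply: contraT => ng.
have [_ /forall_inP/(_ _ gF)/forall_inP/(_ _ gF')] := andP hF.
by rewrite ng => /forall_inP/(_ _ cU); rewrite {2}ec e eqxx.
Qed.

Lemma card_covered : #|covered F| = (#|F| * #|U|)%N.
Proof.
rewrite -cardsX card_in_imset // => -[gam c] [gam' c'].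
rewrite !finset.in_setX /= => /andP[h1 h2] /andP[h3 h4] e.
by have [-> ->] := pack_inj h1 h3 h2 e.
Qed.

(** The choice is unambiguous by [pack_inj]; seeds and all vertices outside the packing are
    fixed. *)
Definition swap_fun (v : 'I_n) : 'I_n :=
  if [pick p : {ffun C -> 'I_n} * C | [&& p.1 \in F, p.2 \in U & p.1 p.2 == v]] is Some p
  then p.1 (sw p.2) else v.

Lemma swap_in gam c : gam \in F -> c \in U -> swap_fun (gam c) = gam (sw c).
Proof.
move=> gF cU; rewrite /swap_fun; case: pickP => [[gam' c'] /= /and3P[h1 h2 /eqP e]|/(_ (gam, c))].
  by have [-> ->] := pack_inj h1 gF h2 e.
by rewrite /= gF cU eqxx.
Qed.

Lemma swap_out v : v \notin covered F -> swap_fun v = v.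
Proof.
move=> vF; rewrite /swap_fun; case: pickP => // -[gam c] /= /and3P[h1 h2 /eqP e].
by case/coveredP: vF; exists gam, c.
Qed.

Lemma swap_fK : involutive swap_fun.
Proof.
move=> v; have [/coveredP[gam [c [h1 h2 ->]]]|h] := boolP (v \in covered F).
  by rewrite swap_in // swap_in ?swK //; have [] := sw_in h2.
by rewrite !swap_out.
Qed.

Definition swap_perm : 'S_n := perm (inv_inj swap_fK).

Lemma swap_permE gam c : gam \in F -> swap_perm (gam c) = gam (sw c).
Proof.
move=> gF; rewrite permE; have [cU|cU] := boolP (c \in U); first exact: swap_in.
rewrite swap_out ?sw_out //; apply/coveredP => -[gam' [c' [h1 h2 e]]].
have ec := placement_coord (pack_place gF) (pack_place h1) e.
by rewrite ec h2 in cU.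
Qed.

Lemma swap_perm_inv : (swap_perm^-1 = swap_perm)%g.
Proof.
apply/permP => v; apply: (@perm_inj _ swap_perm); rewrite permKV.
by rewrite [RHS]permE [swap_perm v]permE swap_fK.
Qed.

Lemma covered_Der : covered F \subset Der swap_perm.
Proof.
apply/fintype.subsetP => _ /coveredP[gam [c [h1 h2 ->]]]; rewrite inE swap_permE //.
apply/eqP => e; have [_] := sw_in h2.
by rewrite (placement_coord (pack_place h1) (pack_place h1) e) eqxx.
Qed.

Definition pack_edges : {set {set 'I_n}} :=
  [set gedge p.1 p.2 | p in finset.setX F D]%SET.

(** The swap is an involution and, by [D_sw], maps a gadget edge to an edge of the same placement,
    which is present in [g]. *)
Lemma pack_edges_overlap : pack_edges \subset overlap swap_perm g g.
Proof.
apply/fintype.subsetP => z /imsetP[[gam [a b]] /=]; rewrite finset.in_setX => /andP[/= gF dD] ->.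
rewrite overlapP (presentP (pack_present gF)) //= swap_perm_inv.
have -> : (swap_perm @: gedge gam (a, b))%SET = gedge gam (sw a, sw b).
  by rewrite /gedge imsetU !imset_set1 /= !swap_permE.
by apply: presentP (pack_present gF) _; apply: D_sw.
Qed.

(** The tail of an edge lies in [U], where distinct placements of the packing are disjoint, so it
    determines the placement. *)
Lemma pack_edge_inj : {in finset.setX F D &, injective (fun p => gedge p.1 p.2)}.
Proof.
move=> [gam [a b]] [gam' d']; rewrite !finset.in_setX /= => /andP[h1 h2] /andP[h3 h4] e.
have [<- e1 e2] := gedge_inj (pack_place h1) (pack_place h3) h2 h4 e.
by have [-> _] := pack_inj h1 h3 (D_tail h2) e1.
Qed.

(* The left-hand side counts the edges of the packing minus [y] times the number
   of available vertices. Each edge not inside [w >= y] sends a unit mass to the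
   vertices of load less than [y]. *)
Lemma pack_load (R : realType) (y : R) : is_graph g -> 0 <= y ->
  #|F|%:R * #|D|%:R - y * (#|covered F|%:R + \sum_(c | c \notin U) #|Part c|%:R) <=
  #|D|%:R * #|[set v in covered F | y <= balanced_load (overlap swap_perm g g) v]%SET|%:R :> R.
Proof.
move=> gg y0; have gH := overlap_graph swap_perm gg.
have [th [al ba lE]] := balanced_loadP (R := R) gH.
pose H := overlap swap_perm g g; rewrite -/H in gH al ba lE *.
set A := [set v in covered F | _]%SET.
have sH : pack_edges \subset H := pack_edges_overlap.
pose w := load H th; pose B := [set v | y <= w v]%SET.
(* All the vertices that an edge of the packing can meet. *)
pose W := (covered F :|: \bigcup_(c | c \notin U) Part c)%SET.
have edgeW e v : e \in pack_edges -> v \in e -> v \in W.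
  move=> /imsetP[[gam [a b]] /=]; rewrite finset.in_setX => /andP[/= gF dD] ->.
  have cW c : gam c \in W.
    rewrite inE; have [cU|cU] := boolP (c \in U).
      by apply/orP; left; apply/coveredP; exists gam, c.
    apply/orP; right; apply/bigcupP; exists c => //.
    exact: placementP (pack_place gF).
  by move=> /set2P[] ->; apply: cW.
have cardW : #|W|%:R <= #|covered F|%:R + \sum_(c | c \notin U) #|Part c|%:R :> R.
  rewrite -natr_sum -natrD ler_nat (leq_trans (leq_card_setU _ _)) // leq_add2l.
  elim/big_rec2: _ => [|c m S _ h]; first by rewrite cards0.
  by rewrite (leq_trans (leq_card_setU _ _)) // leq_add2l.
have wW : \sum_(v in W :\: B) w v <= y * #|W|%:R.
  apply: (@le_trans _ _ (\sum_(v in W :\: B) y)).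
    apply: ler_sum => v; rewrite finset.in_setD inE -ltNge => /andP[h _]; exact: ltW.
  rewrite sumr_const -[_ *+ _]mulr_natr ler_wpM2l // ler_nat.
  exact/subset_leq_card/subsetDl.
(* Only the mass received outside [B]: by balance, an edge with an endpoint outside [B] brings
   exactly one unit of it. *)
pose f u v : R := if v \in B then 0 else th u v.
have th0 u v : [set u; v]%SET \in H -> 0 <= th u v by case/al => /andP[].
have h1 : \sum_v \sum_(u | [set u; v]%SET \in pack_edges) f u v <= \sum_(v in W :\: B) w v.
  rewrite [leRHS]big_mkcond; apply: ler_sum => v _.
  have [vB|vB] := boolP (v \in B).
    by rewrite finset.in_setD vB /= big1 // => u _; rewrite /f vB.
  rewrite finset.in_setD vB /=; case: ifP => vW.
    rewrite /w /load [leLHS]big_mkcond [leRHS]big_mkcond; apply: ler_sum => u _.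
    rewrite /f (negPf vB); case: ifP => [/(fintype.subsetP sH) ->//|_].
    by case: ifP => // /th0.
  rewrite big1 // => u uvH; case/negP: vW.
  by apply: edgeW uvH _; rewrite !inE eqxx orbT.
have h2 : \sum_(e in pack_edges) (~~ (e \subset B))%:R <=
    \sum_v \sum_(u | [set u; v]%SET \in pack_edges) f u v.
  rewrite sum_edges; apply: ler_sum => e ep.
  have eH := fintype.subsetP sH _ ep.
  have [a [b [ab eE]]] := graph_edgeP gH eH.
  rewrite {2}eE sum_pair // /f.
  have abH : [set a; b]%SET \in H by rewrite -eE.
  have baH : [set b; a]%SET \in H by rewrite finset.setUC.
  have [_ ts] := al _ _ abH; have t1 := th0 _ _ abH; have t2 := th0 _ _ baH.
  have nB v : v \notin B -> w v < y by rewrite inE -ltNge.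
  have iB v : v \in B -> y <= w v by rewrite inE.
  have [aB|aB] := boolP (a \in B); have [bB|bB] := boolP (b \in B).
  - have -> : e \subset B by apply/fintype.subsetP => v; rewrite eE => /set2P[]->.
    by rewrite addr0.
  - rewrite addr0 -[th a b](addrK (th b a)) ts (ba _ _ baH) ?subr0 ?lern1 ?leq_b1 //.
    exact: lt_le_trans (nB _ bB) (iB _ aB).
  - rewrite add0r -[th b a](addrK (th a b)) [th b a + _]addrC ts (ba _ _ abH) ?subr0 ?lern1 ?leq_b1 //.
    exact: lt_le_trans (nB _ aB) (iB _ bB).
  - by rewrite ts lern1 leq_b1.
(* An edge inside [B] has its tail in [A], and is determined by this tail and its element of [D]. *)
have h3 : #|F|%:R * #|D|%:R <= \sum_(e in pack_edges) (~~ (e \subset B))%:R + #|D|%:R * #|A|%:R :> R.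
  rewrite -!natrM -natr_sum -natrD ler_nat -cardsX -(card_in_imset pack_edge_inj).
  rewrite -/pack_edges -sum1_card (bigID (fun e : {set 'I_n} => e \subset B)) /= addnC.
  apply: leq_add.
    by rewrite big_mkcondr /=; apply: leq_sum => e _; case: (_ \subset _).
  rewrite sum1dep_card -cardsX.
  rewrite (_ : [set e in pack_edges | e \subset B]%SET =
    [set gedge p.1 p.2 | p in [set p in finset.setX F D | gedge p.1 p.2 \subset B]%SET]%SET); last first.
    apply/setP => e; rewrite inE; apply/andP/imsetP => [[/imsetP[p pX ->] sB]|[p]].
      by exists p => //; rewrite inE pX.
    by rewrite inE => /andP[pX sB] ->; split => //; apply: imset_f.
  apply: leq_trans (leq_imset_card _ _) _.
  rewrite -(card_in_imset (f := fun p : {ffun C -> 'I_n} * (C * C) => (p.2, p.1 p.2.1))).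
    apply: subset_leq_card; apply/fintype.subsetP => z /imsetP[[gam [a b]]].
    rewrite inE finset.in_setX => /andP[/andP[/= gF dD] sB] ->.
    rewrite finset.in_setX dD /= inE; apply/andP; split.
      by apply/coveredP; exists gam, a; split => //; apply: D_tail dD.
    have := fintype.subsetP sB (gam a); rewrite set21 => /(_ isT).
    by rewrite inE lE.
  move=> [gam [a b]] [gam' [a' b']]; rewrite !inE => /andP[/andP[/= gF dD] _] /andP[/andP[/= gF' _] _].
  case=> <- <- e; have [->//] := pack_inj gF gF' (D_tail dD) e.
rewrite lerBlDr; apply: le_trans h3 _; rewrite addrC lerD2l.
apply: le_trans (le_trans h2 (le_trans h1 wW)) _.
by rewrite ler_wpM2l.
Qed.
End Packing.
End Gadget.

Lemma card_family_prod (A B : finType) (F : A -> pred B) :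
  #|(family F : pred {ffun A -> B})| = (\prod_a #|F a|)%N.
Proof. by rewrite card_family foldrE big_image. Qed.

(** * Second moment method for packings *)

Section GadgetProb.
Context {R : realType} {C : finType} {n : nat}.
Variables (U : {set C}) (D : {set C * C}) (Part : C -> {set 'I_n}) (p C0 : R).
Hypothesis D_anti : forall a b, (a, b) \in D -> (b, a) \notin D.
Hypothesis Part_inj : forall c c' v, v \in Part c -> v \in Part c' -> c = c'.
Hypotheses (U0 : U != finset.set0) (n0 : (0 < n)%N) (p0 : 0 < p) (p1 : p <= 1).
Hypotheses (Part0 : forall c, (0 < #|Part c|)%N) (C00 : 0 < C0).

Definition inner_edges (I : {set C}) : nat := #|[set d in D | (d.1 \in I) && (d.2 \in I)]%SET|.

Hypothesis sparse : forall I : {set C}, I :&: U != finset.set0 ->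
  (\prod_(c in I) #|Part c|%:R^-1) * p^-1 ^+ inner_edges I <= C0 / n%:R.

Let placement := placement Part.
Implicit Types (gam : {ffun C -> 'I_n}) (g : {set {set 'I_n}}).

Definition max_packing g : {set {ffun C -> 'I_n}} :=
  [arg max_(F > finset.set0 | packing U D Part g F) #|F|].

Lemma max_packingP g : packing U D Part g (max_packing g) /\
  forall F, packing U D Part g F -> (#|F| <= #|max_packing g|)%N.
Proof.
rewrite /max_packing; case: arg_maxnP => [|F hF hmax]; last by split.
apply/andP; split; first exact: finset.sub0set.
by apply/forall_inP => gam; rewrite inE.
Qed.

Definition packed g := covered U (max_packing g).

(** Otherwise [gam] could be added to the packing, against maximality. *)
Lemma max_packing_hit g gam : placement gam -> present D gam g ->
  exists2 c, c \in U & gam c \in packed g.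
Proof.
move=> hg pg; have [pF Fmax] := max_packingP g.
have [c0 c0U] := set0Pn _ U0.
have [gF|gF] := boolP (gam \in max_packing g).
  by exists c0 => //; apply/coveredP; exists gam, c0.
apply: contrapT => nh.
have hd gam' c : gam' \in max_packing g -> c \in U -> gam c != gam' c.
  move=> g'F cU; apply: contra_notN nh => /eqP e; exists c => //.
  by rewrite e; apply/coveredP; exists gam', c.
suff /Fmax : packing U D Part g (gam |: max_packing g)%SET by rewrite cardsU1 gF ltnn.
have [/fintype.subsetP sF /forall_inP dF] := andP pF.
apply/andP; split.
  apply/fintype.subsetP => gam'; rewrite !inE => /orP[/eqP ->|/sF]; last by rewrite inE.
  by apply/andP.
apply/forall_inP => g1; rewrite !inE => h1; apply/forall_inP => g2; rewrite !inE => h2.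
apply/implyP => ne; apply/forall_inP => c cU.
case/orP: h1 => h1; case/orP: h2 => h2.
- by rewrite (eqP h1) (eqP h2) eqxx in ne.
- by rewrite (eqP h1) hd.
- by rewrite (eqP h2) eq_sym hd.
- by have /forall_inP/(_ _ h2)/implyP/(_ ne)/forall_inP/(_ _ cU) := dF _ h1.
Qed.

Let edges gam : {set {set 'I_n}} := [set gedge gam d | d in D]%SET.

Lemma present_edges gam g : present D gam g = (edges gam \subset g).
Proof.
apply/forall_inP/fintype.subsetP => [h _ /imsetP[d dD ->]|h d dD]; first exact: h.
by apply: h; apply: imset_f.
Qed.

Lemma edges_pairs gam : placement gam -> edges gam \subset pairs n.
Proof.
move=> hg; apply/fintype.subsetP => _ /imsetP[[a b] dD ->].
by rewrite inE cards2 (gedge_neq D_anti Part_inj hg dD).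
Qed.

Lemma card_edges gam : placement gam -> #|edges gam| = #|D|.
Proof.
move=> hg; apply: card_in_imset => d d' dD dD' e.
by have [] := gedge_inj D_anti Part_inj hg hg dD dD' e.
Qed.

Lemma Ex_subset (S : {set {set 'I_n}}) : S \subset pairs n ->
  Ex (edge_prob p) (fun g => (S \subset g)%:R) = p ^+ #|S|.
Proof.
move=> /fintype.subsetP sS.
rewrite -prodr_const (eq_bigr (edge_prob p)) => [|e /sS eS]; last by rewrite /edge_prob eS.
by rewrite -Ex_set; apply: eq_Ex => g; case: (S \subset g).
Qed.

Definition agree (gam gam' : {ffun C -> 'I_n}) : {set C} := [set c | gam c == gam' c]%SET.

(** Two placements share only edges whose two coordinates lie in [agree gam gam']. *)
Lemma Ex_present2 gam gam' : placement gam -> placement gam' ->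
  Ex (edge_prob p) (fun g => (present D gam g && present D gam' g)%:R) <=
  p ^+ (2 * #|D|) * p^-1 ^+ inner_edges (agree gam gam').
Proof.
move=> hg hg'.
rewrite (@eq_Ex _ _ _ _ (fun g => ((edges gam :|: edges gam')%SET \subset g)%:R)); last first.
  by move=> g; rewrite !present_edges finset.subUset.
rewrite Ex_subset ?finset.subUset ?edges_pairs // exprVn ler_pdivlMr ?exprn_gt0 // -exprD.
apply: ler_wiXn2l; rewrite ?(ltW p0) //.
have sI : (#|edges gam :&: edges gam'| <= inner_edges (agree gam gam'))%N.
  apply: leq_trans (leq_imset_card (gedge gam) _); apply: subset_leq_card.
  apply/fintype.subsetP => e; rewrite inE => /andP[/imsetP[d dD e1] /imsetP[d' dD' e2]].
  rewrite e1 in e2; have [ed a1 a2] := gedge_inj D_anti Part_inj hg hg' dD dD' e2.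
  apply/imsetP; exists d => //; rewrite inE dD !inE /=.
  by rewrite a1 a2 !eqxx.
have := cardsUI (edges gam) (edges gam'); rewrite !card_edges //.
by move: sI; rewrite mul2n -addnn; move: #|_| #|_| => a b; lia.
Qed.

Let Gam := #|[pred gam | placement gam]|.

Lemma card_placement : Gam = (\prod_c #|Part c|)%N.
Proof. by rewrite -(card_family_prod (fun c => mem (Part c))); apply: eq_card. Qed.

Lemma card_agree gam (I : {set C}) : placement gam ->
  #|[set gam' | placement gam' && (agree gam gam' == I)]%SET|%:R <=
  Gam%:R * \prod_(c in I) #|Part c|%:R^-1 :> R.
Proof.
move=> hg.
apply: (@le_trans _ _ (\prod_c (if c \in I then 1 else #|Part c|)%N)%:R).
  rewrite ler_nat; apply: (@leq_trans #|family (fun c => if c \in I then pred1 (gam c) else mem (Part c))|).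
    apply: subset_leq_card; apply/fintype.subsetP => gam'; rewrite inE => /andP[hg' /eqP eI].
    apply/familyP => c; case: ifP => [|_]; last exact: placementP.
    by rewrite -eI inE eq_sym => h; rewrite inE.
  by rewrite card_family_prod; apply: leq_prod => c _; case: ifP => _; rewrite ?card1.
rewrite card_placement [X in _ <= _ * X]big_mkcond /= !natr_prod -big_split /=.
apply: ler_prod => c _; rewrite ler0n /=; case: ifP => _; last by rewrite mulr1.
by rewrite mulfV // pnatr_eq0 -lt0n.
Qed.

Let mu : R := Gam%:R * p ^+ #|D|.

Lemma Ex_card_present :
  Ex (edge_prob p) (fun g => \sum_(gam | placement gam) (present D gam g)%:R) = mu.
Proof.
rewrite Ex_sum (eq_bigr (fun=> p ^+ #|D|)) => [|gam hg].
  by rewrite sumr_const -[LHS]mulr_natl.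
rewrite -(card_edges hg) -Ex_subset ?edges_pairs //.
by apply: eq_Ex => g; rewrite present_edges.
Qed.

Let C1 : R := #|U|%:R * 2 ^+ #|C| * C0.

(** Pairs are grouped by the set [I] on which they agree. By [card_agree], [Ex_present2] and
    [sparse], each [I] meeting [U] contributes at most [C0 * mu ^+ 2 / n], and there are at most
    [2 ^+ #|C|] such sets. *)
Lemma Ex_present_pairs :
  Ex (edge_prob p) (fun g => \sum_(gam | placement gam) \sum_(gam' | placement gam')
     (agree gam gam' :&: U != finset.set0)%:R * (present D gam g && present D gam' g)%:R) <=
  2 ^+ #|C| * C0 * mu ^+ 2 / n%:R.
Proof.
rewrite Ex_sum.
apply: (@le_trans _ _ (\sum_(gam | placement gam) (Gam%:R * p ^+ (2 * #|D|) * (2 ^+ #|C| * (C0 / n%:R))))); last first.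
  rewrite sumr_const -[_ *+ _]mulr_natl -/Gam le_eqVlt; apply/orP; left; apply/eqP.
  by rewrite /mu exprMn mulnC exprM; ring.
apply: ler_sum => gam hg; rewrite Ex_sum.
apply: (@le_trans _ _ (\sum_(gam' | placement gam') \sum_(I : {set C} | I :&: U != finset.set0)
    (agree gam gam' == I)%:R * (p ^+ (2 * #|D|) * p^-1 ^+ inner_edges I))).
  apply: ler_sum => gam' hg'; rewrite ExZ.
  have [h|h] := boolP (agree gam gam' :&: U != finset.set0); last first.
    rewrite mul0r; apply: sumr_ge0 => I _.
    by rewrite !mulr_ge0 ?ler0n ?exprn_ge0 ?invr_ge0 ?(ltW p0).
  rewrite mul1r (bigD1 (agree gam gam')) //= eqxx mul1r.
  apply: le_trans (Ex_present2 hg hg') _; rewrite lerDl; apply: sumr_ge0 => I _.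
  by rewrite !mulr_ge0 ?ler0n ?exprn_ge0 ?invr_ge0 ?(ltW p0).
rewrite exchange_big /=.
have -> : 2 ^+ #|C| * (C0 / n%:R) = \sum_(I : {set C}) (C0 / n%:R).
  rewrite sumr_const -[RHS]mulr_natl -natrX; congr (_%:R * _).
  by rewrite -[RHS]cardsT -powersetT card_powerset cardsT.
rewrite mulr_sumr [leLHS]big_mkcond; apply: ler_sum => I _.
have c0 : 0 <= C0 / n%:R by rewrite divr_ge0 ?ler0n ?(ltW C00).
case: ifP => hI; last by rewrite !mulr_ge0 ?ler0n ?exprn_ge0 ?invr_ge0 ?ler0n ?(ltW p0) ?(ltW C00).
have -> : \sum_(gam' | placement gam') (agree gam gam' == I)%:R * (p ^+ (2 * #|D|) * p^-1 ^+ inner_edges I) =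
   #|[set gam' | placement gam' && (agree gam gam' == I)]%SET|%:R * (p ^+ (2 * #|D|) * p^-1 ^+ inner_edges I).
  by rewrite -mulr_suml -natr_sum -sum1dep_card [in RHS]big_mkcondr; congr (_%:R * _).
apply: (@le_trans _ _ (Gam%:R * \prod_(c in I) #|Part c|%:R^-1 * (p ^+ (2 * #|D|) * p^-1 ^+ inner_edges I))).
  by rewrite ler_wpM2r ?card_agree // mulr_ge0 ?exprn_ge0 ?invr_ge0 ?(ltW p0).
have -> : Gam%:R * \prod_(c in I) #|Part c|%:R^-1 * (p ^+ (2 * #|D|) * p^-1 ^+ inner_edges I) =
  Gam%:R * p ^+ (2 * #|D|) * ((\prod_(c in I) #|Part c|%:R^-1) * p^-1 ^+ inner_edges I) by ring.
by rewrite ler_wpM2l ?sparse // mulr_ge0 ?ler0n ?exprn_ge0 ?(ltW p0).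
Qed.

(* A maximal packing meets every present placement; then sum
   [2 t X_v <= 1 + t ^+ 2 * X_v ^+ 2] over the covered vertices [v], where [X_v] is
   the number of present placements through [v]. *)
Lemma packed_lower_bound g (t : R) : 0 <= t ->
  2 * t * \sum_(gam | placement gam) (present D gam g)%:R <=
  #|packed g|%:R + t ^+ 2 * (#|U|%:R *
   \sum_(gam | placement gam) \sum_(gam' | placement gam')
     (agree gam gam' :&: U != finset.set0)%:R * (present D gam g && present D gam' g)%:R).
Proof.
move=> t0.
pose im gam : {set 'I_n} := [set gam c | c in U]%SET.
pose X v : R := \sum_(gam | placement gam) (present D gam g && (v \in im gam))%:R.
have h1 : \sum_(gam | placement gam) (present D gam g)%:R <= \sum_(v in packed g) X v.
  rewrite exchange_big /=; apply: ler_sum => gam hg.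
  case pg : (present D gam g) => /=; last by apply: sumr_ge0 => v _; rewrite ler0n.
  have [c cU cp] := max_packing_hit hg pg.
  rewrite (bigD1 (gam c)) //= imset_f // lerDl; apply: sumr_ge0 => v _; exact: ler0n.
have h2 : \sum_v X v ^+ 2 <= #|U|%:R *
   \sum_(gam | placement gam) \sum_(gam' | placement gam')
     (agree gam gam' :&: U != finset.set0)%:R * (present D gam g && present D gam' g)%:R.
  rewrite (eq_bigr (fun v => \sum_(gam | placement gam) \sum_(gam' | placement gam')
    ((present D gam g && (v \in im gam))%:R * (present D gam' g && (v \in im gam'))%:R))); last first.
    by move=> v _; rewrite expr2 big_distrlr.
  rewrite exchange_big mulr_sumr; apply: ler_sum => gam hg.
  rewrite exchange_big mulr_sumr; apply: ler_sum => gam' hg'.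
  case: (present D gam g); last by rewrite big1 ?mulr0 // => v _; rewrite mul0r.
  case: (present D gam' g); last by rewrite big1 ?mulr0 // => v _; rewrite mulr0.
  rewrite /= mulr1.
  have aU v : v \in im gam -> v \in im gam' -> agree gam gam' :&: U != finset.set0.
    move=> /imsetP[c cU ->] /imsetP[c' cU' e].
    have ec := placement_coord Part_inj hg hg' e.
    by apply/set0Pn; exists c; rewrite !inE cU andbT {2}ec e.
  have [h|h] := boolP (agree gam gam' :&: U != finset.set0); last first.
    rewrite mulr0 big1 // => v _; case vg: (v \in im gam); last by rewrite mul0r.
    by case vg': (v \in im gam'); rewrite ?mulr0 //; case/negP: h; apply: aU vg vg'.
  rewrite mulr1; apply: (@le_trans _ _ (\sum_v (v \in im gam)%:R)).
    by apply: ler_sum => v _; rewrite -natrM ler_nat; case: (_ \in im gam); case: (_ \in im gam').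
  rewrite -natr_sum ler_nat; apply: leq_trans (leq_imset_card gam U).
  rewrite -sum1_card [leqRHS]big_mkcond; by apply: leq_sum => v _; case: (v \in _).
apply: (@le_trans _ _ (2 * t * \sum_(v in packed g) X v)).
  by rewrite ler_wpM2l ?mulr_ge0.
apply: (@le_trans _ _ (\sum_(v in packed g) (1 + t ^+ 2 * X v ^+ 2))).
  rewrite mulr_sumr; apply: ler_sum => v _.
  by have := sqr_ge0 (1 - t * X v); rewrite !expr2; lra.
rewrite big_split /= sumr_const lerD2l -mulr_sumr ler_wpM2l ?exprn_ge0 //.
apply: le_trans h2; rewrite [leLHS]big_mkcond; apply: ler_sum => v _.
by case: ifP => // _; rewrite exprn_ge0 // sumr_ge0 // => gam _; rewrite ler0n.
Qed.

Lemma Ex_packed : n%:R / C1 <= Ex (edge_prob p) (fun g => #|packed g|%:R).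
Proof.
have nR : 0 < n%:R :> R by rewrite ltr0n.
have mu0 : 0 < mu.
  by rewrite mulr_gt0 ?exprn_gt0 // ltr0n card_placement prodn_gt0.
have C10 : 0 < C1.
  by rewrite mulr_gt0 ?mulr_gt0 ?exprn_gt0 // ltr0n card_gt0.
(* The optimal value: the linear term becomes [2 * n / C1] and the quadratic one at most
   [n / C1]. *)
pose t := n%:R / (C1 * mu).
have t0 : 0 <= t by rewrite divr_ge0 ?ler0n // mulr_ge0 ?(ltW C10) ?(ltW mu0).
have p01 (e : {set 'I_n}) : 0 <= edge_prob p e <= 1.
  by rewrite /edge_prob; case: ifP => _; rewrite ?lexx ?ler01 ?(ltW p0).
have := ler_Ex p01 (fun g => packed_lower_bound g t0).
rewrite ExZ Ex_card_present ExD ExZ ExZ => h.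
have h2 : t ^+ 2 * (#|U|%:R * (2 ^+ #|C| * C0 * mu ^+ 2 / n%:R)) = n%:R / C1.
  have -> : #|U|%:R * (2 ^+ #|C| * C0 * mu ^+ 2 / n%:R) = C1 * mu ^+ 2 / n%:R.
    by rewrite /C1; ring.
  by rewrite /t; field; rewrite !lt0r_neq0.
have h3 : 2 * t * mu = n%:R / C1 + n%:R / C1.
  by rewrite /t; field; rewrite !lt0r_neq0.
have h4 := ler_wpM2l (exprn_ge0 2 t0) (ler_wpM2l (ler0n R #|U|) Ex_present_pairs).
rewrite h2 in h4; rewrite h3 in h.
move: h h4; set E := Ex _ (fun g => #|packed g|%:R); set E2 := _ * (_ * Ex _ _) => h h4.
lra.
Qed.

(** A variable bounded by [n] with mean at least [n / C1] exceeds half of this mean with probability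
    at least [1 / (2 * C1)]. *)
Lemma packed_prob : (2 * C1)^-1 <=
  Ex (edge_prob p) (fun g => (n%:R / (2 * C1) <= (#|packed g|%:R : R))%R%:R).
Proof.
have nR : 0 < n%:R :> R by rewrite ltr0n.
have C10 : 0 < C1.
  by rewrite mulr_gt0 ?mulr_gt0 ?exprn_gt0 // ltr0n card_gt0.
have p01 (e : {set 'I_n}) : 0 <= edge_prob p e <= 1.
  by rewrite /edge_prob; case: ifP => _; rewrite ?lexx ?ler01 ?(ltW p0).
have h g : (#|packed g|%:R : R) <= n%:R / (2 * C1) * 1 + n%:R * (n%:R / (2 * C1) <= (#|packed g|%:R : R))%R%:R.
  have c0 : 0 <= n%:R / (2 * C1) by rewrite divr_ge0 ?ler0n // mulr_ge0 ?(ltW C10).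
  rewrite mulr1; case: (leP (n%:R / (2 * C1)) #|packed g|%:R) => [_|/ltW] /=.
    by rewrite mulr1; apply: ler_wpDl => //; rewrite ler_nat -[leqRHS]card_ord max_card.
  by rewrite mulr0 addr0.
have := le_trans Ex_packed (ler_Ex p01 h).
rewrite ExD !ExZ Ex1 mulr1; move: (Ex _ _) => E hE.
have : n%:R / C1 = n%:R * ((2 * C1)^-1 + (2 * C1)^-1) by field; rewrite lt0r_neq0.
move=> e; rewrite e in hE.
have : n%:R * (2 * C1)^-1 <= n%:R * E by lra.
by rewrite ler_pM2l.
Qed.
End GadgetProb.

(** * From packings to overlap loads *)

Section GadgetTail.
Context {R : realType} {C : finType} {n : nat}.
Variables (U : {set C}) (sw : C -> C) (D : {set C * C}) (Part : C -> {set 'I_n}) (p C0 : R).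
Hypotheses (swK : involutive sw) (sw_out : forall c, c \notin U -> sw c = c)
  (sw_in : forall c, c \in U -> sw c \in U /\ sw c != c).
Hypotheses (D_tail : forall a b, (a, b) \in D -> a \in U)
  (D_anti : forall a b, (a, b) \in D -> (b, a) \notin D)
  (D_sw : forall a b, (a, b) \in D -> (sw a, sw b) \in D).
Hypothesis Part_inj : forall c c' v, v \in Part c -> v \in Part c' -> c = c'.
Hypotheses (U0 : U != finset.set0) (D0 : (0 < #|D|)%N) (n0 : (0 < n)%N) (p0 : 0 < p) (p1 : p <= 1).
Hypotheses (Part0 : forall c, (0 < #|Part c|)%N) (C00 : 0 < C0).
Hypothesis sparse : forall I : {set C}, I :&: U != finset.set0 ->
  (\prod_(c in I) #|Part c|%:R^-1) * p^-1 ^+ inner_edges D I <= C0 / n%:R.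

Let C1 : R := #|U|%:R * 2 ^+ #|C| * C0.
Let rho : R := #|D|%:R / #|U|%:R.

(** [rho] is the number of edges of the packing per covered vertex. In [pack_load], half of the
    guaranteed surplus [(rho - y) * n / (2 * C1)] pays for the seeds, and the other half yields
    linearly many vertices of load at least [y]. *)
Lemma packed_overlap (g : {set {set 'I_n}}) (y eps : R) :
  is_graph g -> 0 <= y <= rho -> n%:R / (2 * C1) <= (#|packed U D Part g|%:R : R) ->
  y * \sum_(c | c \notin U) #|Part c|%:R <= (rho - y) * n%:R / (4 * C1) ->
  eps <= (rho - y) / (4 * C1 * #|D|%:R) ->
  (y%:E <= max_overlap_load eps g)%E.
Proof.
move=> gg /andP[y0 yr] hp hs he.
have nR : 0 < n%:R :> R by rewrite ltr0n.
have UR : 0 < #|U|%:R :> R by rewrite ltr0n card_gt0.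
have DR : 0 < #|D|%:R :> R by rewrite ltr0n.
have C10 : 0 < C1 by rewrite mulr_gt0 ?mulr_gt0 ?exprn_gt0.
have [hF _] := max_packingP U D Part g.
apply/max_overlap_load_geP.
exists (swap_perm swK sw_in Part_inj hF).
set s := swap_perm _ _ _ _.
exists [set v in packed U D Part g | y <= balanced_load (overlap s g g) v]%SET; split.
- apply: (fintype.subset_trans _ (covered_Der swK sw_out sw_in Part_inj hF)).
  by apply/fintype.subsetP => v; rewrite inE => /andP[].
- have := pack_load swK sw_out sw_in D_tail D_anti D_sw Part_inj hF gg y0.
  rewrite -/s -/(packed U D Part g).
  have cE : (#|max_packing U D Part g|%:R : R) * #|D|%:R = #|packed U D Part g|%:R * rho.
    rewrite /packed (card_covered Part_inj hF) natrM /rho; field.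
    by rewrite gt_eqF.
  rewrite cE; set A := #|[set v in packed _ _ _ _ | _]%SET|%:R => h.
  have h1 : (rho - y) * (n%:R / (2 * C1)) <= (rho - y) * #|packed U D Part g|%:R.
    by rewrite ler_wpM2l // subr_ge0.
  have h2 : (rho - y) * (n%:R / (2 * C1)) = (rho - y) * n%:R / (4 * C1) + (rho - y) * n%:R / (4 * C1).
    by field; rewrite gt_eqF.
  have h3 : (rho - y) * n%:R / (4 * C1) <= #|D|%:R * A by move: h h1 h2 hs; lra.
  have h4 : eps * n%:R <= (rho - y) / (4 * C1 * #|D|%:R) * n%:R by rewrite ler_wpM2r ?ler0n.
  apply: le_trans h4 _; rewrite -(ler_pM2l DR); apply: le_trans h3.
  rewrite le_eqVlt; apply/orP; left; apply/eqP; field.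
  by rewrite !gt_eqF.
- by move=> v; rewrite inE => /andP[].
Qed.

Lemma gadget_tail (d : measure_display) (T : measurableType d) (P : probability T R)
    (K : T -> {set {set 'I_n}}) (y eps : R) :
  erdos_renyi P p K -> 0 <= y <= rho ->
  y * \sum_(c | c \notin U) #|Part c|%:R <= (rho - y) * n%:R / (4 * C1) ->
  eps <= (rho - y) / (4 * C1 * #|D|%:R) ->
  (((2 * C1)^-1)%:E <= P [set t | (y%:E <= max_overlap_load eps (K t))%E]%classic)%E.
Proof.
move=> eK hy hs he; have [rK _ _] := eK.
pose Q (g : {set {set 'I_n}}) := n%:R / (2 * C1) <= (#|packed U D Part g|%:R : R).
apply: (@le_trans _ _ (P [set t | Q (K t)]%classic)).
  rewrite (graph_law Q eK) lee_fin.
  exact: (packed_prob D_anti Part_inj U0 n0 p0 p1 Part0 C00 sparse).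
apply: le_measure; rewrite ?inE.
- exact: measurable_graph_event.
- exact: (@measurable_graph_event _ _ _ _ (fun g => y%:E <= max_overlap_load eps g)%E).
- by move=> t /= Qt; apply: packed_overlap => //; apply: rK.1.
Qed.
End GadgetTail.

(** * The path gadget *)

(** The value at 0 is false because the first vertex of a path has no predecessor. *)
Definition prev_at (l : nat -> bool) (j : nat) : bool := if j is j'.+1 then l j' else false.

Section PathExponent.
Context {R : realType}.
Variables (a : R) (l0 l1 : nat -> bool).
Hypothesis a_itv : 1 / 2 < a <= 1.

(* [1 + seed_rate = 1 / (2 * a - 1)]: one path edge and [seed_rate] seed edges per
   path vertex. *)
Definition seed_rate : R := (2 - 2 * a) / (2 * a - 1).

(** Increments of a truncated linear function, so that the seeds are spread as evenly as
    possible. *)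
Definition seed_count (j : nat) : nat :=
  (Num.truncn (j.+1%:R * seed_rate) - Num.truncn (j%:R * seed_rate))%N.

Lemma seed_rate_ge0 : 0 <= seed_rate.
Proof. by have /andP[h1 h2] := a_itv; rewrite divr_ge0; lra. Qed.

Let frac j : R := j%:R * seed_rate - (Num.truncn (j%:R * seed_rate))%:R.

Lemma frac_itv j : 0 <= frac j < 1.
Proof.
have h : 0 <= j%:R * seed_rate by rewrite mulr_ge0 ?ler0n ?seed_rate_ge0.
have /andP[h1 h2] := truncn_itv h.
by rewrite /frac subr_ge0 h1 /= ltrBlDr addrC natr1.
Qed.

Lemma seed_count_mono j : (Num.truncn (j%:R * seed_rate) <= Num.truncn (j.+1%:R * seed_rate))%N.
Proof. by apply: le_truncn; rewrite ler_wpM2r ?seed_rate_ge0 // ler_nat. Qed.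

Lemma seed_countE j : (seed_count j)%:R = seed_rate - frac j.+1 + frac j :> R.
Proof.
by rewrite /seed_count natrB ?seed_count_mono // /frac -natr1; ring.
Qed.

Lemma sum_seed_count r : (\sum_(j < r) seed_count j = Num.truncn (r%:R * seed_rate))%N.
Proof.
elim: r => [|r IH]; first by rewrite big_ord0 mul0r truncn0.
by rewrite big_ord_recr /= IH /seed_count subnKC // seed_count_mono.
Qed.

(** The least contribution of position [j] to the number of vertices minus [a] times the number of
    edges: a seed attached to two occupied vertices contributes [1 - 2 * a], to one [1 - a >= 0],
    and seeds of the latter kind are best left out. *)
Definition path_cost j : R :=
  (l0 j)%:R + (l1 j)%:R - a * ((l0 j && prev_at l0 j)%:R + (l1 j && prev_at l1 j)%:R)
  - (2 * a - 1) * (seed_count j)%:R * (l0 j && l1 j)%:R.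

(* The fractional part of [k * seed_rate] is the credit left by the seeds
   already attached to a run of positions occupied on both sides. *)
Lemma path_cost_inv k :
  [exists j : 'I_k, l0 j || l1 j]%:R + (prev_at l0 k && prev_at l1 k)%:R * ((2 * a - 1) * frac k) <=
  \sum_(j < k) path_cost j.
Proof.
have /andP[ha1 ha2] := a_itv.
elim: k => [|k IH].
  rewrite big_ord0 /= mul0r addr0; case: existsP => [[[]]|] //.
rewrite big_ord_recr /= /path_cost seed_countE.
(* Inside a run occupied on both sides, this makes the cost of a position equal to the increment of
   [(2 * a - 1) * frac]. *)
have hr : (2 * a - 1) * seed_rate = 2 - 2 * a by rewrite /seed_rate; field; lra.
have /andP[f0 f1] := frac_itv k; have /andP[f0' f1'] := frac_itv k.+1.
have -> : (2 * a - 1) * (seed_rate - frac k.+1 + frac k) =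
   2 - 2 * a - (2 * a - 1) * frac k.+1 + (2 * a - 1) * frac k by rewrite -hr; ring.
have u0 : 0 <= (2 * a - 1) * frac k by rewrite mulr_ge0 //; lra.
have u1 : (2 * a - 1) * frac k <= 2 * a - 1 by rewrite ler_piMr //; lra.
have v0 : 0 <= (2 * a - 1) * frac k.+1 by rewrite mulr_ge0 //; lra.
have v1 : (2 * a - 1) * frac k.+1 <= 2 * a - 1 by rewrite ler_piMr //; lra.
move: IH u0 u1 v0 v1; set u := _ * frac k; set v := _ * frac k.+1 => IH u0 u1 v0 v1.
have -> : [exists j : 'I_k.+1, l0 j || l1 j] = [exists j : 'I_k, l0 j || l1 j] || (l0 k || l1 k).
  apply/existsP/orP => [[j lj]|[/existsP[j lj]|lk]].
  - case: (ltnP j k) => jk; first by left; apply/existsP; exists (Ordinal jk).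
    have -> : k = j by apply/eqP; rewrite eqn_leq jk -ltnS ltn_ord.
    by right.
  - by exists (widen_ord (leqnSn k) j).
  - by exists ord_max.
have pe : prev_at l0 k || prev_at l1 k -> [exists j : 'I_k, l0 j || l1 j].
  by case: k {IH} @u @v u0 u1 v0 v1 f0 f1 f0' f1' => // k *; apply/existsP; exists ord_max.
move: IH pe; case: [exists j : 'I_k, _]; case: (prev_at l0 k); case: (prev_at l1 k);
  case: (l0 k); case: (l1 k) => //= IH pe; try (by have := pe isT); lra.
Qed.

Lemma path_cost_ge1 r : (exists j, [/\ (j < r)%N & l0 j || l1 j]) ->
  1 <= \sum_(j < r) path_cost j.
Proof.
have /andP[ha1 ha2] := a_itv.
move=> [j [jr lj]]; apply: le_trans (path_cost_inv r).
have -> : [exists j : 'I_r, l0 j || l1 j] by apply/existsP; exists (Ordinal jr).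
have /andP[f0 f1] := frac_itv r.
by rewrite lerDl !mulr_ge0 ?ler0n //; lra.
Qed.
End PathExponent.

Lemma sum_ltn M x : (\sum_(i < M) (i < x) = minn M x)%N.
Proof.
elim: M => [|M IH]; first by rewrite big_ord0 min0n.
by rewrite big_ord_recr /= IH; case: (ltnP M x) => h /=; lia.
Qed.

(** * Two paths attached to common seeds *)

Section PathGadget.
Variables (r M : nat) (xs : nat -> nat).
Hypothesis xsM : forall j, (j < r)%N -> (xs j <= M)%N.

(* Two copies, indexed by [bool], of a path with [r] vertices, and seeds [(j, i)];
   for [i < xs j] the seed [(j, i)] is joined to the [j]-th vertex of both paths,
   the other seeds are isolated. *)
Definition coord : finType := ((bool * 'I_r) + ('I_r * 'I_M))%type.

Definition path_coords : {set coord} := [set c : coord | if c is inl _ then true else false]%SET.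

Definition flip (c : coord) : coord :=
  if c is inl (b, j) then inl (~~ b, j) else c.

Definition gadget_adj (c c' : coord) : bool :=
  match c, c' with
  | inl (b, j), inl (b', j') => (b == b') && (j' == j.+1 :> nat)
  | inl (b, j), inr (j', i) => (j' == j) && (i < xs j)%N
  | _, _ => false
  end.

Definition gadget_edges : {set coord * coord} := [set d | gadget_adj d.1 d.2]%SET.

Lemma flipK : involutive flip.
Proof. by case=> [[b j]|s] //=; rewrite negbK. Qed.

Lemma flip_out c : c \notin path_coords -> flip c = c.
Proof. by rewrite inE; case: c => [[]|]. Qed.

Lemma flip_in c : c \in path_coords -> flip c \in path_coords /\ flip c != c.
Proof.
rewrite !inE; case: c => [[b j]|] //= _; split => //.
by apply/eqP => -[]; case: b.
Qed.

Lemma gadget_tailU a b : (a, b) \in gadget_edges -> a \in path_coords.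
Proof. by rewrite !inE /=; case: a => [[]|]. Qed.

Lemma gadget_anti a b : (a, b) \in gadget_edges -> (b, a) \notin gadget_edges.
Proof.
rewrite !inE /=; case: a b => [[b j]|[j i]] [[b' j']|[j' i']] //=.
by move=> /andP[_ /eqP e]; rewrite e negb_and; apply/orP; right; lia.
Qed.

Lemma gadget_flip a b : (a, b) \in gadget_edges -> (flip a, flip b) \in gadget_edges.
Proof.
rewrite !inE /=; case: a b => [[b j]|[j i]] [[b' j']|[j' i']] //=.
by rewrite (inj_eq negb_inj).
Qed.

Lemma sum_coord (V : nmodType) (F : coord -> V) :
  \sum_c F c = \sum_(j < r) (F (inl (true, j)) + F (inl (false, j)) + \sum_i F (inr (j, i))).
Proof.
rewrite big_sumType /= big_split /=; congr (_ + _); last first.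
  by rewrite pair_bigA; apply: eq_bigr => -[].
transitivity (\sum_(b : bool) \sum_(j < r) F (inl (b, j))).
  by rewrite pair_bigA; apply: eq_bigr => -[].
by rewrite big_bool big_split.
Qed.

Lemma sum_coord_nat (F : coord -> nat) :
  (\sum_c F c = \sum_(j < r) (F (inl (true, j)) + F (inl (false, j)) + \sum_i F (inr (j, i))))%N.
Proof. exact: (sum_coord F). Qed.

Lemma card_path_coords : #|path_coords| = (2 * r)%N.
Proof.
rewrite -sum1_card big_mkcond sum_coord.
rewrite (eq_bigr (fun=> 2%N)) => [|j _]; first by rewrite sum_nat_const card_ord mulnC.
by rewrite !inE big1 // => i _; rewrite inE.
Qed.

Lemma path_coords0 : (0 < r)%N -> path_coords != finset.set0.
Proof. by rewrite -card_gt0 card_path_coords => r0; rewrite muln_gt0. Qed.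

Section Inner.
Variable I : {set coord}.

(** Positions range over [nat] to match [path_cost]; none is occupied from [r] on. *)
Definition occupied (b : bool) (j : nat) : bool :=
  if insub j is Some j' then (inl (b, j') : coord) \in I else false.

Let seed (j : 'I_r) (i : 'I_M) : bool := (inr (j, i) : coord) \in I.

Lemma occupiedE b (j : 'I_r) : occupied b j = ((inl (b, j) : coord) \in I).
Proof. by rewrite /occupied valK. Qed.

Lemma inner_edgesE : inner_edges gadget_edges I =
  (\sum_(j < r) \sum_(b : bool) ((occupied b j && prev_at (occupied b) j) +
     \sum_(i < M) (occupied b j && (seed j i && (i < xs j)%N))))%N.
Proof.
rewrite /inner_edges -sum1_card big_mkcond /=.
rewrite (eq_bigr (fun d : coord * coord => (gadget_adj d.1 d.2 && ((d.1 \in I) && (d.2 \in I))) : nat)); last first.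
  by move=> d _; rewrite !inE; case: (_ && _).
rewrite -(pair_bigA _ (fun c c' : coord => (gadget_adj c c' && ((c \in I) && (c' \in I))) : nat)) /=.
rewrite sum_coord_nat.
transitivity (\sum_(j < r) \sum_(b : bool) \sum_c' ((gadget_adj (inl (b, j)) c' && (((inl (b, j) : coord) \in I) && (c' \in I))) : nat))%N.
  apply: eq_bigr => j _; rewrite [X in (_ + X)%N]big1 => [|i _]; last by rewrite big1.
  by rewrite big_bool addn0.
rewrite exchange_big [RHS]exchange_big /=; apply: eq_bigr => b _.
rewrite (eq_bigr (fun j : 'I_r => (\sum_(j' < r) ((j' == j.+1 :> nat) && (occupied b j && occupied b j')) +
    \sum_(i < M) (occupied b j && (seed j i && (i < xs j))))%N)); last first.
  move=> j _; rewrite sum_coord_nat big_split /=; congr (_ + _)%N.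
    apply: eq_bigr => j' _; rewrite !occupiedE.
    by case: b; rewrite /= ?addn0 ?add0n.
  rewrite (bigD1 j) //= [X in (_ + X)%N]big1 ?addn0 => [|j' /negPf j'j]; last first.
    by rewrite big1 // => i _; rewrite j'j.
  apply: eq_bigr => i _; rewrite eqxx occupiedE /seed /=; congr (nat_of_bool _).
  by case: (_ \in I); case: (_ \in I); case: (i < xs j)%N.
rewrite !big_split /=; congr (_ + _)%N.
(* Each path edge is counted at its later endpoint, so position 0 contributes none. *)
rewrite exchange_big /=; apply: eq_bigr => j' _.
case: j' => [[|j'] hj'] /=; first by rewrite andbF big1 // => j _.
have hj : (j' < r)%N by apply: ltnW.
rewrite (bigD1 (Ordinal hj)) //= eqxx /= big1 ?addn0 1?andbC // => j ne.
rewrite eqSS; case: eqP => // e; case/eqP: ne; exact/val_inj.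
Qed.

(** Every seed contributes at least what [path_cost] assigns to it, whether or not it belongs to
    [I]; [path_cost_ge1] concludes. *)
Lemma inner_exponent (R : realType) (a : R) : 1 / 2 < a <= 1 ->
  (forall j, (j < r)%N -> xs j = seed_count a j) ->
  I :&: path_coords != finset.set0 ->
  1 <= #|I|%:R - a * (inner_edges gadget_edges I)%:R.
Proof.
move=> ha hxs /set0Pn[c]; rewrite inE => /andP[cI cU].
have /andP[ha1 ha2] := ha.
apply: (@le_trans _ _ (\sum_(j < r) path_cost a (occupied false) (occupied true) j)).
  apply: path_cost_ge1 => //; move: cU cI; rewrite inE.
  case: c => [[b j] _ jI|//]; exists j; split => //.
  by rewrite !occupiedE; case: b jI => ->; rewrite ?orbT.
have -> : #|I|%:R = \sum_(j < r) ((occupied true j)%:R + (occupied false j)%:R +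
    \sum_(i < M) (seed j i)%:R) :> R.
  rewrite -sum1_card big_mkcond sum_coord_nat natr_sum; apply: eq_bigr => j _.
  by rewrite !natrD natr_sum !occupiedE; congr (_%:R + _%:R + _).
rewrite inner_edgesE natr_sum mulr_sumr -sumrB.
apply: ler_sum => j _; rewrite big_bool /path_cost.
set s := \sum_(i < M) _.
have hs : - ((2 * a - 1) * (seed_count a j)%:R * (occupied false j && occupied true j)%:R) <=
   s - a * (\sum_(i < M) (occupied true j && (seed j i && (i < xs j)%N))%:R +
            \sum_(i < M) (occupied false j && (seed j i && (i < xs j)%N))%:R).
  have cx : (seed_count a j)%:R = \sum_(i < M) (i < xs j)%N%:R :> R.
    by rewrite -natr_sum sum_ltn -hxs // (minn_idPr (xsM (ltn_ord j))).
  rewrite cx -big_split !mulr_sumr mulr_suml -sumrN /s -sumrB; apply: ler_sum => i _ /=.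
  by case: (occupied true j); case: (occupied false j); case: (seed j i); case: (i < xs j)%N; rewrite /= ?mulr1 ?mulr0 ?addr0 ?add0r; lra.
move: hs; rewrite !natrD !natr_sum.
case: (occupied true j); case: (occupied false j); rewrite /= ?mulr1 ?mulr0; lra.
Qed.
End Inner.

Lemma card_gadget_edges : (0 < r)%N ->
  #|gadget_edges| = (2 * (r.-1 + \sum_(j < r) xs j))%N.
Proof.
move=> r0.
have -> : #|gadget_edges| = inner_edges gadget_edges [set: coord]%SET.
  by apply: eq_card => d; rewrite [RHS]inE !finset.in_setT !andbT.
rewrite inner_edgesE.
rewrite (eq_bigr (fun j : 'I_r => 2 * ((j != 0 :> nat) + xs j))%N); last first.
  move=> j _; rewrite big_bool /= mul2n -addnn.
  have h b : ((occupied [set: coord]%SET b j && prev_at (occupied [set: coord]%SET b) j) +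
     \sum_(i < M) (occupied [set: coord]%SET b j && (((inr (j, i) : coord) \in [set: coord]%SET) && (i < xs j))) =
     (j != 0 :> nat) + xs j)%N.
    rewrite occupiedE finset.in_setT /=; congr (_ + _)%N.
      case: j => [[|j] hj] //=; have hj' : (j < r)%N by apply: ltnW.
      by rewrite -[j]/(val (Ordinal hj')) occupiedE finset.in_setT.
    rewrite (eq_bigr (fun i : 'I_M => (i < xs j)%N : nat)); last first.
      by move=> i _; rewrite finset.in_setT.
    by rewrite sum_ltn (minn_idPr (xsM (ltn_ord j))).
  by rewrite !h.
rewrite -big_distrr big_split /=; congr (2 * (_ + _))%N.
case: r r0 => // r' _; rewrite big_ord_recl /= add0n.
by rewrite sum1_card card_ord.
Qed.
End PathGadget.

(** * Lower bound *)

Lemma exists_parts (C : finType) (n : nat) (sz : C -> nat) : (\sum_c sz c <= n)%N ->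
  exists Part : C -> {set 'I_n}, (forall c, #|Part c| = sz c) /\
    (forall c c' v, v \in Part c -> v \in Part c' -> c = c').
Proof.
move=> hn; pose S : finType := {c : C & 'I_(sz c)}.
have hS : (#|S| <= n)%N.
  rewrite card_tagged sumnE big_map big_enum /=.
  by under eq_bigr do rewrite card_ord.
pose f (x : S) : 'I_n := widen_ord hS (enum_rank x).
have f_inj : injective f.
  by move=> x x' /(congr1 val) /= /val_inj/enum_rank_inj.
exists (fun c => [set f (Tagged (fun c => 'I_(sz c)) i) | i : 'I_(sz c)]%SET); split=> [c|c c' v].
  rewrite card_imset ?card_ord // => i i' /f_inj /eqP.
  by rewrite -tag_eqE /tag_eq eqxx /= tagged_asE => /eqP.
by move=> /imsetP[i _ ->] /imsetP[i' _ /f_inj/(congr1 tag)].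
Qed.

(** Collects the powers of [N]: a vertex brings a factor [1 / N], an edge a factor [N ^ alpha]. *)
Lemma sparse_estimate (R : realType) (C : finType) (I : {set C}) (q : C -> R)
    (N B m lambda alpha : R) (e : nat) :
  0 < N -> 0 < lambda -> lambda^-1 <= m -> 0 <= B ->
  (forall c, c \in I -> 0 <= q c <= B / N) ->
  (\prod_(c in I) q c) * (lambda / N `^ alpha)^-1 ^+ e <=
  B ^+ #|I| * m ^+ e * N `^ (alpha * e%:R - #|I|%:R).
Proof.
move=> N0 l0 lm B0 hq.
have m0 : 0 <= m by apply: le_trans lm; rewrite invr_ge0 ltW.
have h1 : \prod_(c in I) q c <= (B / N) ^+ #|I|.
  by rewrite -prodr_const; apply: ler_prod.
have h2 : (lambda / N `^ alpha)^-1 ^+ e <= m ^+ e * N `^ (alpha * e%:R).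
  rewrite invf_div exprMn mulrC powRrM powR_mulrn ?powR_ge0 // ler_wpM2r ?exprn_ge0 ?powR_ge0 //.
  by rewrite lerXn2r ?nnegrE ?invr_ge0 ?(ltW l0).
have -> : B ^+ #|I| * m ^+ e * N `^ (alpha * e%:R - #|I|%:R) =
    (B / N) ^+ #|I| * (m ^+ e * N `^ (alpha * e%:R)).
  rewrite powRD ?(gt_eqF N0) ?implybT // powRN powR_mulrn ?(ltW N0) // expr_div_n; ring.
apply: ler_pM => //; first by apply: prodr_ge0 => c /hq/andP[].
by rewrite exprn_ge0 // invr_ge0 divr_ge0 ?powR_ge0 ?(ltW l0).
Qed.

Lemma divn_lower (R : realType) (n m : nat) : (0 < m)%N -> (m <= n)%N ->
  0 <= ((n %/ m)%:R^-1 : R) <= (2 * m)%:R / n%:R.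
Proof.
move=> m0 mn; rewrite invr_ge0 ler0n /=.
have d0 : (0 < n %/ m)%N by rewrite divn_gt0.
have n0 : (0 < n)%N by apply: leq_trans mn.
rewrite -[leLHS]mul1r ler_pdivrMr ?ltr0n // mulrAC ler_pdivlMr ?ltr0n // mul1r -natrM ler_nat.
have := divn_eq n m; have := ltn_pmod n m0; move: (n %/ m)%N (n %% m)%N d0 => x z x0 zm ->.
nia.
Qed.

(** A gadget designed for an exponent [a > alpha] has a spare negative power of [n], which absorbs
    constants; [a] close to [alpha] keeps its density above [y]. For [alpha = 1] the constraint
    [a <= 1] forces [a = 1], and the gadget has no seeds. *)
Lemma exists_exponent (R : realType) (alpha y : R) : 1 / 2 < alpha <= 1 -> 0 < y ->
  y < 1 / (2 * alpha - 1) ->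
  exists a, [/\ 1 / 2 < a <= 1, y < 1 / (2 * a - 1) & (alpha < a /\ a < alpha + 1) \/ (alpha = 1 /\ a = 1)].
Proof.
move=> /andP[h1 h2] y0 hy; have [e|ne] := eqVneq alpha 1.
  by exists 1; split; [lra|move: hy; rewrite e|right].
have a1 : alpha < 1 by rewrite lt_neqAle ne.
have hy' : alpha < (1 + y^-1) / 2.
  move: hy; rewrite ltr_pdivlMr; last by lra.
  rewrite mulrC -ltr_pdivlMr // mul1r => hy; lra.
(* For [a > 1 / 2], the condition [y < 1 / (2 * a - 1)] is [a < (1 + y^-1) / 2]. *)
pose a := (alpha + Num.min 1 ((1 + y^-1) / 2)) / 2.
have ma : alpha < Num.min 1 ((1 + y^-1) / 2) by rewrite lt_min a1.
have m1 : Num.min 1 ((1 + y^-1) / 2) <= 1 by rewrite ge_min lexx.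
have m2 : Num.min 1 ((1 + y^-1) / 2) <= (1 + y^-1) / 2 by rewrite ge_min lexx orbT.
exists a; rewrite /a; move: ma m1 m2; set m := Num.min _ _ => ma m1 m2.
split; [lra| |left; lra].
rewrite ltr_pdivlMr; last lra.
rewrite mulrC -ltr_pdivlMr // mul1r; lra.
Qed.

(** With an edge, the gain is [(a - alpha) * e]. Without edges there are at least two vertices, and
    [a < alpha + 1] suffices. A single vertex is excluded since its exponent is exactly -1. *)
Lemma exponent_gap (R : realType) (alpha a : R) (i e : nat) :
  alpha < a -> a < alpha + 1 -> 1 <= i%:R - a * e%:R -> ~~ ((i == 1%N) && (e == 0%N)) ->
  alpha * e%:R - i%:R <= - (a - alpha) - 1.
Proof.
move=> h1 h2 hexp nE; have [e0|epos] := posnP e.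
  have i0 : (0 < i)%N by move: hexp; rewrite e0 mulr0 subr0 ler1n.
  have i2 : (2 <= i)%N by move: nE; rewrite e0 andbT; lia.
  have : (2 : R) <= i%:R by rewrite (ler_nat _ 2).
  rewrite e0; lra.
have e1 : (1 : R) <= e%:R by rewrite ler1n.
have : (a - alpha) * 1 <= (a - alpha) * e%:R by rewrite ler_wpM2l // subr_ge0 ltW.
lra.
Qed.

(** * Sizes of the parts and constants *)

Section LowerTail.
Context {R : realType}.
Variables (lambda alpha a : R) (r : nat).
Hypotheses (l0 : 0 < lambda) (ha : 1 / 2 < a <= 1) (halpha : 0 < alpha) (r0 : (0 < r)%N).
Hypothesis alpha_a : (alpha < a /\ a < alpha + 1) \/ (alpha = 1 /\ a = 1).

Let M := Num.truncn (r%:R * seed_rate a).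
Let xs := seed_count a.
Let C : finType := coord r M.
Let U : {set C} := path_coords r M.
Let D : {set C * C} := gadget_edges r M xs.
Let m : R := Num.max 1 lambda^-1.
(** Independent of the divisor [k] of the seed parts, which is chosen afterwards in terms of this
    constant. *)
Let C0 : R := (8 * r)%:R ^+ (2 * r) * m ^+ #|D|.

Let m_ge1 : 1 <= m. Proof. by rewrite le_max lexx. Qed.
Let lm : lambda^-1 <= m. Proof. by rewrite le_max lexx orbT. Qed.

Lemma seed_count_le j : (j < r)%N -> (xs j <= M)%N.
Proof.
move=> jr; rewrite /M -(sum_seed_count ha) (bigD1 (Ordinal jr)) //=.
exact: leq_addr.
Qed.

Let size8 : 1 <= (8 * r)%:R :> R.
Proof. by rewrite ler1n muln_gt0. Qed.

Lemma C0_ge : (8 * r)%:R <= C0.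
Proof.
apply: (@le_trans _ _ ((8 * r)%:R ^+ (2 * r))).
  by rewrite -[leLHS]expr1 ler_weXn2l // muln_gt0.
by rewrite ler_peMr ?exprn_ge0 ?exprn_ege1 // ?(le_trans ler01).
Qed.

(** The path parts take at most half of the vertices; [k] makes the seed parts as small as
    needed. *)
Let size_of (k n : nat) (c : C) : nat := if c is inl _ then (n %/ (4 * r))%N else (n %/ k)%N.

Lemma sum_size_of (k n : nat) : (2 * (r * M) < k)%N -> (\sum_c size_of k n c <= n)%N.
Proof.
move=> hk; rewrite sum_coord_nat /=.
rewrite (eq_bigr (fun=> (2 * (n %/ (4 * r)) + M * (n %/ k))%N)); last first.
  by move=> j _; rewrite sum_nat_const card_ord mul2n addnn.
rewrite sum_nat_const card_ord.
have h1 : (n %/ (4 * r) * (4 * r) <= n)%N by apply: leq_trunc_div.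
have h2 : (n %/ k * k <= n)%N by apply: leq_trunc_div.
move: h1 h2; move: (n %/ (4 * r))%N (n %/ k)%N => u v h1 h2.
have h3 : (2 * (r * M) * v <= n)%N.
  by apply: leq_trans h2; rewrite mulnC leq_mul2l (ltnW hk) orbT.
nia.
Qed.

(** If [alpha = a = 1] there are no seeds, so the constants do not involve [k] and the exponent is
    at most -1. If [alpha < a], a single path vertex is bounded by its part size, and for any other
    [I] the factor [n ^ - (a - alpha)] beats the constant [G] depending on [k]. *)
Lemma gadget_sparse (k : nat) : (0 < k)%N ->
  \forall n \near \oo, forall (Part : C -> {set 'I_n}),
    (forall c, #|Part c| = size_of k n c) ->
    forall I : {set C}, I :&: U != finset.set0 ->
    (\prod_(c in I) #|Part c|%:R^-1) * (lambda / n%:R `^ alpha)^-1 ^+ inner_edges D I <= C0 / n%:R.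
Proof.
move=> k0.
pose B : R := (8 * r + 2 * k)%:R.
have B1 : 1 <= B by rewrite ler1n ltn_addr // muln_gt0.
pose G : R := B ^+ #|C| * m ^+ #|D|.
(* A positive exponent fixed before [n]; 1 is a placeholder when [alpha = a]. *)
have [dl dl0 dlE] : exists2 dl, 0 < dl & alpha < a -> a - alpha = dl.
  case: alpha_a => [[h _]|[-> ->]]; first by exists (a - alpha); rewrite ?subr_gt0.
  by exists 1 => //; rewrite ltxx.
near=> n => Part szP I IU.
have n0 : (0 < n)%N by near: n; exact: nbhs_infty_gt.
have nR : 0 < n%:R :> R by rewrite ltr0n.
have n1 : 1 <= n%:R :> R by rewrite ler1n.
have nr : (4 * r <= n)%N by near: n; exact: nbhs_infty_ge.
have nk : (k <= n)%N by near: n; exact: nbhs_infty_ge.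
have r4 : (0 < 4 * r)%N by rewrite muln_gt0.
have hU c : c \in U -> 0 <= (#|Part c|%:R^-1 : R) <= (8 * r)%:R / n%:R.
  rewrite inE szP; case: c => // _ _ /=; rewrite -[8%N]/(2 * 4)%N -mulnA.
  exact: divn_lower.
have hC c : 0 <= (#|Part c|%:R^-1 : R) <= B / n%:R.
  rewrite szP; case: c => [_|_] /=.
    have /andP[-> h] := divn_lower R r4 nr; rewrite (le_trans h) //.
    apply: ler_wpM2r; first by rewrite invr_ge0 ler0n.
    by rewrite /B ler_nat mulnA leq_addr.
  have /andP[-> h] := divn_lower R k0 nk; rewrite (le_trans h) //.
  apply: ler_wpM2r; first by rewrite invr_ge0 ler0n.
  by rewrite /B ler_nat leq_addl.
set e := inner_edges D I.
have hexp : 1 <= #|I|%:R - a * e%:R.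
  by apply: inner_exponent IU => //; exact: seed_count_le.
have /andP[ha1 ha2] := ha.
have eD : (e <= #|D|)%N.
  by apply: subset_leq_card; apply/fintype.subsetP => d; rewrite inE => /andP[].
have me : m ^+ e <= m ^+ #|D| by rewrite ler_weXn2l.
have m0 : 0 <= m by apply: le_trans m_ge1.
case: alpha_a => [[aa1 aa2]|[al1 aa1]]; last first.
  have M0 : M = 0%N.
    by rewrite /M /seed_rate aa1 (_ : 2 - 2 * 1 = 0) ?mul0r ?mulr0 ?truncn0 //; ring.
  have allU c : c \in U.
    rewrite inE; case: c => // -[j i].
    by have := ltn_ord i; rewrite [X in (_ < X)%N]M0.
  apply: le_trans (sparse_estimate alpha e nR l0 lm _ (fun c _ => hU c (allU c))) _; first exact: ler0n.
  have cI : (#|I| <= 2 * r)%N by rewrite -(card_path_coords r M); apply: subset_leq_card; apply/fintype.subsetP.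
  rewrite /C0; apply: ler_pM.
  - by rewrite mulr_ge0 ?exprn_ge0 ?ler0n.
  - exact: powR_ge0.
  - by apply: ler_pM; rewrite ?exprn_ge0 ?ler0n // ler_weXn2l.
  - rewrite -[leRHS]powR_inv1 ?ler0n // ler_powR //.
    by move: hexp; rewrite al1 aa1 !mul1r => h; rewrite -opprB lerN2.
have small : B ^+ #|I| * m ^+ e * n%:R `^ (alpha * e%:R - #|I|%:R) <= C0 / n%:R \/
    (exists c, I = [set c]%SET /\ e = 0%N).
  have [IE|nE] := boolP ((#|I| == 1%N) && (e == 0%N)).
    right; case/andP: IE => /cards1P[c ->] /eqP e0; by exists c.
  left; have hneg := exponent_gap aa1 aa2 hexp nE.
  apply: (@le_trans _ _ (G * (n%:R `^ (- (a - alpha)) / n%:R))).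
    apply: ler_pM.
    - by rewrite mulr_ge0 ?exprn_ge0 // (le_trans _ B1).
    - exact: powR_ge0.
    - apply: ler_pM; rewrite ?exprn_ge0 ?(le_trans _ B1) // ler_weXn2l //.
      exact: max_card.
    - rewrite -(powR_inv1 (ltW nR)) -powRD ?(gt_eqF nR) ?implybT //.
      by rewrite ler_powR.
  rewrite mulrA ler_wpM2r ?invr_ge0 ?ler0n // powRN ler_pdivrMr ?powR_gt0 //.
  apply: (@le_trans _ _ (n%:R `^ (a - alpha))).
    by rewrite dlE //; near: n; apply: powR_infty.
  by rewrite ler_peMl ?powR_ge0 // (le_trans _ C0_ge).
case: small => [small|[c [Ic e0]]].
  apply: le_trans (sparse_estimate alpha e nR l0 lm _ (fun c _ => hC c)) small.
  by rewrite (le_trans _ B1).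
rewrite e0 expr0 mulr1 Ic big_set1.
have cU : c \in U.
  by move/set0Pn: IU => [c']; rewrite Ic !inE => /andP[/eqP ->].
have /andP[_ h] := hU c cU; apply: le_trans h _.
by rewrite ler_pM2r ?invr_gt0 // C0_ge.
Unshelve. all: by end_near. Qed.

Let rho : R := #|D|%:R / #|U|%:R.

(** Each path of [r] vertices carries [r - 1 + M] edges: one is lost at the end of the path, and
    less than one by truncation in [M]. *)
Lemma gadget_density : 1 / (2 * a - 1) - 2 / r%:R <= rho.
Proof.
have rR : 0 < r%:R :> R by rewrite ltr0n.
have /andP[ha1 ha2] := ha.
have hM : r%:R * seed_rate a - 1 <= M%:R.
  have /andP[_ h] := truncn_itv (mulr_ge0 (ler0n R r) (seed_rate_ge0 ha)).
  by rewrite lerBlDr natr1 ltW.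
have rE : rho = (r%:R - 1 + M%:R) / r%:R.
  rewrite /rho card_path_coords card_gadget_edges //; last exact: seed_count_le.
  rewrite (sum_seed_count ha) -/M !natrM natrD -subn1 natrB //.
  by field; rewrite gt_eqF.
rewrite rE ler_pdivlMr //.
have -> : (1 / (2 * a - 1) - 2 / r%:R) * r%:R = r%:R * seed_rate a + r%:R - 2.
  by rewrite /seed_rate; field; rewrite gt_eqF //=; lra.
lra.
Qed.

Lemma lower_tail_gadget (y : R) (d : nat -> measure_display)
    (T : forall n : nat, measurableType (d n)) (P : forall n : nat, probability (T n) R)
    (K : forall n : nat, T n -> {set {set 'I_n}}) :
  (forall n : nat, lambda / n%:R `^ alpha <= 1 ->
            erdos_renyi (P n) (lambda / n%:R `^ alpha) (K n)) ->
  0 < y < rho ->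
  exists eps1 q : R, [/\ 0 < eps1, 0 < q & forall eps, eps <= eps1 ->
    \forall n \near \oo, (q%:E <= P n [set t | (y%:E <= max_overlap_load eps (K n t))%E]%classic)%E].
Proof.
move=> hK /andP[y0 yr].
pose C1 : R := #|U|%:R * 2 ^+ #|C| * C0.
have UR : 0 < #|U|%:R :> R by rewrite ltr0n card_path_coords muln_gt0.
have C00 : 0 < C0 by apply: lt_le_trans C0_ge; apply: lt_le_trans size8.
have C10 : 0 < C1 by apply: mulr_gt0 C00; apply: mulr_gt0 => //; rewrite exprn_gt0.
have D0 : (0 < #|D|)%N.
  rewrite lt0n; apply: contraTneq yr => e; rewrite /rho e mul0r -leNgt; exact: ltW.
have DR : 0 < #|D|%:R :> R by rewrite ltr0n.
have ry : 0 < rho - y by rewrite subr_gt0.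
have C4 : 0 < 4 * C1 by apply: mulr_gt0.
exists ((rho - y) / (4 * C1 * #|D|%:R)), (2 * C1)^-1; split.
- by apply: divr_gt0 ry _; apply: mulr_gt0 DR.
- by rewrite invr_gt0; apply: mulr_gt0.
move=> eps heps.
(* [k >= z] makes the [r * M] seed parts small enough for [gadget_tail], and [k > 2 * (r * M)]
   leaves room for disjoint parts. *)
pose z : R := 4 * C1 * (y * (r * M)%:R) / (rho - y).
have z0 : 0 <= z.
  apply: divr_ge0 (ltW ry); apply: mulr_ge0; last by rewrite mulr_ge0 ?ler0n ?(ltW y0).
  by rewrite mulr_ge0 ?ler0n ?(ltW C10).
pose k := (2 * (r * M) + (Num.truncn z).+1)%N.
have k0 : (0 < k)%N by rewrite /k addnS.
have kM : (2 * (r * M) < k)%N by rewrite /k addnS ltnS; apply: leq_addr.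
have zk : z <= k%:R.
  have /andP[_ h] := truncn_itv z0; apply: le_trans (ltW h) _.
  by rewrite ler_nat leq_addl.
have hs := gadget_sparse k0.
near=> n.
have hsn : forall (Part : C -> {set 'I_n}), (forall c, #|Part c| = size_of k n c) ->
    forall I : {set C}, I :&: U != finset.set0 ->
    (\prod_(c in I) #|Part c|%:R^-1) * (lambda / n%:R `^ alpha)^-1 ^+ inner_edges D I <= C0 / n%:R.
  by near: n; exact: hs.
have n0 : (0 < n)%N by near: n; exact: nbhs_infty_gt.
have nR : 0 < n%:R :> R by rewrite ltr0n.
have nr : (4 * r <= n)%N by near: n; exact: nbhs_infty_ge.
have nk : (k <= n)%N by near: n; exact: nbhs_infty_ge.
have na : 0 < n%:R `^ alpha by rewrite powR_gt0.
pose p := lambda / n%:R `^ alpha.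
have p0 : 0 < p by rewrite divr_gt0.
have p1 : p <= 1.
  by rewrite ler_pdivrMr // mul1r; near: n; apply: powR_infty.
have [Part [szP Pinj]] := exists_parts (sum_size_of n kM).
have Part0 c : (0 < #|Part c|)%N.
  by rewrite szP; case: c => _ /=; rewrite divn_gt0 // muln_gt0.
have spars : forall I : {set C}, I :&: U != finset.set0 ->
    (\prod_(c in I) #|Part c|%:R^-1) * p^-1 ^+ inner_edges D I <= C0 / n%:R.
  exact: hsn.
apply: (gadget_tail (@flipK r M) (@flip_out r M) (@flip_in r M) (@gadget_tailU r M xs)
  (@gadget_anti r M xs) (@gadget_flip r M xs) Pinj (path_coords0 M r0) D0 n0 p0 p1 Part0 C00 spars).
- exact: hK.
- by rewrite !ltW.
- have -> : \sum_(c | c \notin path_coords r M) #|Part c|%:R = (r * M)%:R * (n %/ k)%:R :> R.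
    rewrite -natr_sum big_mkcond sum_coord_nat -natrM; congr _%:R.
    rewrite (eq_bigr (fun=> (M * (n %/ k))%N)) => [|j _].
      by rewrite sum_nat_const card_ord mulnA.
    rewrite !inE /= addn0 add0n (eq_bigr (fun=> (n %/ k)%N)) => [|i _].
      by rewrite sum_nat_const card_ord.
    by rewrite inE /= szP.
  have kR : 0 < k%:R :> R by rewrite ltr0n.
  have h1 : (n %/ k)%:R <= n%:R / k%:R :> R.
    by rewrite ler_pdivlMr // -natrM ler_nat leq_trunc_div.
  apply: (@le_trans _ _ (y * ((r * M)%:R * (n%:R / k%:R)))).
    by rewrite !ler_wpM2l ?ler0n ?(ltW y0).
  rewrite -/rho -/C1 ler_pdivlMr //.
  have -> : y * ((r * M)%:R * (n%:R / k%:R)) * (4 * C1) = z * (rho - y) * n%:R / k%:R.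
    by rewrite /z; field; rewrite !gt_eqF.
  rewrite ler_pdivrMr //.
  have -> : (rho - y) * n%:R * k%:R = k%:R * (rho - y) * n%:R by ring.
  by apply: ler_wpM2r (ltW nR) _ _ _; apply: ler_wpM2r (ltW ry) _ _ zk.
- exact: heps.
Unshelve. all: by end_near. Qed.
End LowerTail.

Lemma lower_tail (R : realType) (lambda alpha y : R)
    (d : nat -> measure_display) (T : forall n : nat, measurableType (d n))
    (P : forall n : nat, probability (T n) R)
    (K : forall n : nat, T n -> {set {set 'I_n}}) :
  0 < lambda -> 1 / 2 < alpha <= 1 ->
  (forall n : nat, lambda / n%:R `^ alpha <= 1 ->
            erdos_renyi (P n) (lambda / n%:R `^ alpha) (K n)) ->
  0 < y < 1 / (2 * alpha - 1) ->
  exists eps1 q : R, [/\ 0 < eps1, 0 < q & forall eps, eps <= eps1 ->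
    \forall n \near \oo, (q%:E <= P n [set t | (y%:E <= max_overlap_load eps (K n t))%E]%classic)%E].
Proof.
move=> l0 ha hK /andP[y0 hy].
have [a [aitv ya alpha_a]] := exists_exponent ha y0 hy.
have a0 : 0 < alpha by have /andP[h _] := ha; lra.
have g0 : 0 < 1 / (2 * a - 1) - y by rewrite subr_gt0.
(* Paths so long that the loss [2 / r] of [gadget_density] is smaller than the margin above [y]. *)
pose r := (Num.truncn (2 / (1 / (2 * a - 1) - y))).+1.
have rR : 0 < r%:R :> R by rewrite ltr0n.
have hr : 2 / (1 / (2 * a - 1) - y) < r%:R.
  by have /andP[] := truncn_itv (divr_ge0 (ler0n R 2) (ltW g0)).
apply: (@lower_tail_gadget _ lambda alpha a r l0 aitv a0 (ltn0Sn _) alpha_a y d T P K hK).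
rewrite y0 /=; apply: lt_le_trans (gadget_density aitv (ltn0Sn _)).
rewrite ltrBrDr -ltrBrDl -/r ltr_pdivrMr //.
by move: hr; rewrite ltr_pdivrMr // mulrC.
Qed.

(** * Limits superior in probability and conclusion *)

Lemma plimsup_le (R : realType) (d : nat -> measure_display)
    (T : forall n : nat, measurableType (d n)) (P : forall n : nat, probability (T n) R)
    (X : forall n, T n -> \bar R) (c : R) :
  (forall x, c < x -> P n [set t | (x%:E <= X n t)%E]%classic @[n --> \oo] --> 0%E) ->
  (plimsup P X <= c%:E)%E.
Proof.
move=> h; apply: ge_ereal_sup => _ [x /= hx <-]; rewrite lee_fin leNgt.
by apply: contraTN isT => /h/cvg_limn_einf_sup[_ e]; rewrite e ltxx in hx.
Qed.

Lemma plimsup_ge (R : realType) (d : nat -> measure_display)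
    (T : forall n : nat, measurableType (d n)) (P : forall n : nat, probability (T n) R)
    (X : forall n, T n -> \bar R) (y q : R) : 0 < q ->
  (\forall n \near \oo, (q%:E <= P n [set t | (y%:E <= X n t)%E]%classic)%E) ->
  (y%:E <= plimsup P X)%E.
Proof.
move=> q0 [N _ h]; apply: ereal_sup_ubound; exists y => //=.
apply: (@lt_le_trans _ _ q%:E); first by rewrite lte_fin.
rewrite limn_esup_lim; apply: lime_ge; first exact: is_cvg_esups.
near=> n; apply: (@le_trans _ _ (P (maxn n N) [set t | (y%:E <= X (maxn n N) t)%E]%classic)).
  by apply: h => /=; exact: leq_maxr.
by apply: ereal_sup_ubound; exists (maxn n N) => //=; exact: leq_maxl.
Unshelve. all: by end_near. Qed.

Theorem theorem2 (R : realType) (lambda alpha : R)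
    (hlambda : 0 < lambda) (halpha : 1 / 2 < alpha <= 1)
    (d : nat -> measure_display) (T : forall n : nat, measurableType (d n))
    (P : forall n : nat, probability (T n) R)
    (K : forall n : nat, T n -> {set {set 'I_n}})
    (hgraph : forall n : nat, random_graph (K n))
    (hK : forall n : nat, lambda / n%:R `^ alpha <= 1 ->
            erdos_renyi (P n) (lambda / n%:R `^ alpha) (K n)) :
  SOV P K = (1 / (2 * alpha - 1))%:E.
Proof.
have /andP[ha1 ha2] := halpha.
set c := 1 / (2 * alpha - 1).
have c0 : 0 < c by rewrite divr_gt0 //; lra.
set v := fun eps : R => plimsup P (fun n t => max_overlap_load eps (K n t)).
have vle eps : 0 < eps -> (v eps <= c%:E)%E.
  move=> e0; apply: plimsup_le => x cx.
  exact: (upper_tail_cvg hlambda halpha hK e0 cx).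
have vge y : 0 < y < c -> \forall eps \near 0^'+, (y%:E <= v eps)%E.
  move=> yc; have [eps1 [q [e10 q0 h]]] := lower_tail hlambda halpha hK yc.
  near=> eps; apply: (plimsup_ge q0); apply: h.
  by near: eps; exact: nbhs_right_le.
apply: cvg_lim => //; apply/fine_cvgP; split.
  have hy : 0 < c / 2 < c by rewrite divr_gt0 //=; lra.
  have hv := vge _ hy.
  near=> eps; rewrite fin_numE; apply/andP; split.
    by rewrite gt_eqF // (lt_le_trans (ltNyr (c / 2))) //; near: eps.
  by rewrite lt_eqF // (le_lt_trans (vle eps _)) ?ltry //; near: eps; exact: nbhs_right_gt.
apply/cvgrPdist_le => e e0.
(* [c / 2] keeps [y] positive when [e] is large. *)
pose y := Num.max (c - e) (c / 2).
have hy : 0 < y < c.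
  by rewrite lt_max gt_max divr_gt0 ?orbT //=; apply/andP; split; lra.
have hv := vge _ hy.
near=> eps.
have h1 : (v eps <= c%:E)%E by apply: vle; near: eps; exact: nbhs_right_gt.
have h2 : (y%:E <= v eps)%E by near: eps.
have h3 : c - e <= y by rewrite le_max lexx.
move: h1 h2; rewrite /= -/(v eps); case: (v eps) => [w| |] //=; rewrite !lee_fin => h1 h2.
by rewrite ger0_norm; lra.
Unshelve. all: by end_near. Qed.
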